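(* Algorithm 2 (described in the context) is a $\frac13$-approximation algorithm for the Multiple Knapsack Problem with Cluster Constraints (MKPC): it runs in polynomial time and outputs a feasible assignment of total profit at least $\frac13\mathrm{OPT}$.
   Context: MKPC: items $\mathcal{S}=[m]$ with profits $p_j>0$ and costs $c_j>0$; knapsacks $\mathcal{K}=[p]$ with capacities $B_k>0$, partitioned into clusters $\mathcal{C}=[q]$, cluster $l$ containing knapsacks $\mathcal{K}(l)$ and having capacity $U_l>0$. A feasible assignment assigns each item to at most one knapsack so that the total cost in each knapsack $k$ is at most $B_k$ and the total cost in the knapsacks of each cluster $l$ is at most $U_l$; its value is the total profit of assigned items; $\mathrm{OPT}$ is the maximum value. Standing assumptions: $B_k\le U_l$ for $k\in\mathcal{K}(l)$ and $\sum_{k\in\mathcal{K}(l)}B_k>U_l$. (MKPC is the special case of the maximum coverage problem with cluster constraints in which every set is a singleton $S_j=\{j\}$.) Index $\mathcal{K}(l)=\{1,\dots,n_l\}$ by non-increasing capacity; the critical knapsack $\kappa_l$ satisfies $\sum_{k<\kappa_l}B_k\le U_l<\sum_{k\le\kappa_l}B_k$. Let $z^*_{kl}=B_k/U_l$ for $k<\kappa_l$, $z^*_{\kappa_l l}=1-\sum_{t<\kappa_l}z^*_{tl}$, $z^*_{kl}=0$ for $k>\kappa_l$. $\mathrm{LP}(z^* )$: variables $x_{jk}\in[0,1]$ for $B_k\ge c_j$ (others $0$); maximize $L(x)=\sum_jp_j\sum_kx_{jk}$ subject to $\sum_jc_jx_{jk}\le B_k$ and $\sum_jc_jx_{jk}\le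 U_lz^*_{kl}$ for $k\in\mathcal{K}(l)$, and $\sum_kx_{jk}\le1$. Support graph $H_x$: bipartite graph on $\mathcal{S}\cup\mathcal{K}$ with edges $\{j,k\}$ where $0<x_{jk}<1$; $x$ has the bounded split property if $H_x$ has a matching covering every non-isolated node of $\mathcal{S}$ (an $\mathcal{S}$-saturating matching). Algorithm 2: (1) compute an optimal solution $x^*$ of $\mathrm{LP}(z^* )$; (2) derive from it a feasible solution $x$ of $\mathrm{LP}(z^* )$ with the bounded split property and $L(x)\ge L(x^* )$; (3) let $M$ be an $\mathcal{S}$-saturating matching of $H_x$; (4) set $x^1_{jk}=1$ iff $x_{jk}=1$; $x^2_{jk}=1$ iff $x_{jk}\in(0,1)$, $k$ is not a critical knapsack and $\{j,k\}\in M$; $x^3_{jk}=1$ iff $x_{jk}\in(0,1)$, $k$ is a critical knapsack and $\{j,k\}\in M$ (all other entries $0$); (5) output the one of $x^1,x^2,x^3$ with largest $L$-value. *)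

(* Defs.v *)
From mathcomp Require Import all_boot all_order all_algebra.

Set Implicit Arguments.
Unset Strict Implicit.
Unset Printing Implicit Defensive.

Import Order.TTheory GRing.Theory Num.Theory.
Local Open Scope ring_scope.

(* m items, p knapsacks, q clusters; K(l) is the set of k with clus k = l. *)
Record mkpc (R : realFieldType) (m p q : nat) := Mkpc {
  profit : 'I_m -> R;
  cost : 'I_m -> R;
  capa : 'I_p -> R;
  clus : 'I_p -> 'I_q;
  ucap : 'I_q -> R
}.

Section MKPC.

Variables (R : realFieldType) (m p q : nat) (I : mkpc R m p q).

Record mkpc_valid : Prop := MkpcValid {
  profit_gt0 : forall j, 0 < profit I j;
  cost_gt0 : forall j, 0 < cost I j;
  capa_gt0 : forall k, 0 < capa I k;
  ucap_gt0 : forall l, 0 < ucap I l;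
  capa_le_ucap : forall k, capa I k <= ucap I (clus I k);
  ucap_lt_sum : forall l, ucap I l < \sum_(k | clus I k == l) capa I k
}.

(* f j = Some k when item j is put in knapsack k, f j = None when j is left
   out. *)
Definition assignment := {ffun 'I_m -> option 'I_p}.

Definition load (f : assignment) (k : 'I_p) : R :=
  \sum_(j | f j == Some k) cost I j.

Definition feasible (f : assignment) : bool :=
  [forall k, load f k <= capa I k] &&
  [forall l, \sum_(k | clus I k == l) load f k <= ucap I l].

Definition value (f : assignment) : R := \sum_(j | f j != None) profit I j.

(* The default 0 is harmless: it is the value of the feasible empty
   assignment, and profits are positive. *)
Definition OPT : R := \big[Num.max/0]_(f : assignment | feasible f) value f.

Definition mx_of_assignment (f : assignment) : 'M[R]_(m, p) :=
  \matrix_(j, k) (f j == Some k)%:R.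

(* pi k is the position of knapsack k within its own cluster: pi restricted to
   K(l) is a bijection onto {1, ..., n_l}.  Ties between equal capacities may
   be broken arbitrarily. *)
Record indexing (pi : 'I_p -> nat) : Prop := Indexing {
  indexing_range : forall k,
    (1 <= pi k <= #|[set t | clus I t == clus I k]|)%N;
  indexing_inj : forall k t,
    clus I k = clus I t -> pi k = pi t -> k = t;
  indexing_capa : forall k t,
    clus I k = clus I t -> (pi k <= pi t)%N -> capa I t <= capa I k
}.

Variable pi : 'I_p -> nat.

Definition critical (k : 'I_p) : bool :=
  (\sum_(t | (clus I t == clus I k) && (pi t < pi k)%N) capa I t
     <= ucap I (clus I k)) &&
  (ucap I (clus I k)
     < \sum_(t | (clus I t == clus I k) && (pi t <= pi k)%N) capa I t).

Definition before_critical (k : 'I_p) : bool :=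
  [exists t, [&& clus I t == clus I k, critical t & (pi k < pi t)%N]].

(* z^*_{kl} for l = clus k, the only cluster for which it is used. *)
Definition zstar (k : 'I_p) : R :=
  if before_critical k then capa I k / ucap I (clus I k)
  else if critical k then
    1 - \sum_(t | (clus I t == clus I k) && (pi t < pi k)%N)
           capa I t / ucap I (clus I t)
  else 0.

Record lp_feasible (x : 'M[R]_(m, p)) : Prop := LpFeasible {
  lp_box : forall j k, 0 <= x j k <= 1;
  lp_fit : forall j k, capa I k < cost I j -> x j k = 0;
  lp_capa : forall k, \sum_j cost I j * x j k <= capa I k;
  lp_zstar : forall k,
    \sum_j cost I j * x j k <= ucap I (clus I k) * zstar k;
  lp_item : forall j, \sum_k x j k <= 1
}.

Definition lp_value (x : 'M[R]_(m, p)) : R :=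
  \sum_j profit I j * \sum_k x j k.

Definition lp_optimal (x : 'M[R]_(m, p)) : Prop :=
  lp_feasible x /\ forall x', lp_feasible x' -> lp_value x' <= lp_value x.

(* The support graph H_x is bipartite between items and knapsacks; an edge
   {j, k} is represented by the pair (j, k). *)
Definition support_graph (x : 'M[R]_(m, p)) : {set 'I_m * 'I_p} :=
  [set e | 0 < x e.1 e.2 < 1].

Definition matching (H M : {set 'I_m * 'I_p}) : Prop :=
  M \subset H /\
  forall e f, e \in M -> f \in M -> e.1 = f.1 \/ e.2 = f.2 -> e = f.

Definition saturating_matching (H M : {set 'I_m * 'I_p}) : Prop :=
  matching H M /\
  forall j k, (j, k) \in H -> exists k', (j, k') \in M.

Definition bounded_split (x : 'M[R]_(m, p)) : Prop :=
  exists M, saturating_matching (support_graph x) M.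

Definition cand1 (x : 'M[R]_(m, p)) : 'M[R]_(m, p) :=
  \matrix_(j, k) (x j k == 1)%:R.

Definition cand2 (x : 'M[R]_(m, p)) (M : {set 'I_m * 'I_p}) : 'M[R]_(m, p) :=
  \matrix_(j, k) [&& 0 < x j k < 1, ~~ critical k & (j, k) \in M]%:R.

Definition cand3 (x : 'M[R]_(m, p)) (M : {set 'I_m * 'I_p}) : 'M[R]_(m, p) :=
  \matrix_(j, k) [&& 0 < x j k < 1, critical k & (j, k) \in M]%:R.

(* A run of the algorithm, whose steps leave some choices open: xopt is the LP
   optimum, x the LP solution derived from it, M the matching in the support
   graph of x, and y the output. *)
Record algorithm2_run (xopt x : 'M[R]_(m, p)) (M : {set 'I_m * 'I_p})
    (y : 'M[R]_(m, p)) : Prop := Algorithm2Run {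
  run_indexing : indexing pi;
  run_lp : lp_optimal xopt;
  run_feasible : lp_feasible x;
  run_split : bounded_split x;
  run_value : lp_value xopt <= lp_value x;
  run_matching : saturating_matching (support_graph x) M;
  run_output : y \in [:: cand1 x; cand2 x M; cand3 x M];
  run_best : forall y', y' \in [:: cand1 x; cand2 x M; cand3 x M] ->
    lp_value y' <= lp_value y
}.

End MKPC.

(* Random access machine with logarithmic cost, presented as a structured
    program over finitely many integer arrays.  Every arithmetic
    operation and memory access is charged the number of binary digits of the
    integers (operands, addresses, contents) it handles. *)

Inductive binop := Add | Sub | Mul | Div.

Inductive expr :=
  | Const of int
  | Read of nat & expr
  | Bin of binop & expr & expr.

Inductive cmd :=
  | Skip
  | Write of nat & expr & expr
  | Seq of cmd & cmd
  | If of expr & cmd & cmd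
  | While of expr & cmd.

(* s a i is the content of cell i of array a. *)
Definition store := nat -> nat -> int.

Definition nbits (z : int) : nat := (trunc_log 2 `|z|%N).+1.

Definition binop_val (o : binop) (u v : int) : int :=
  match o with
  | Add => u + v
  | Sub => u - v
  | Mul => u * v
  | Div => (u %/ v)%Z
  end.

(* A negative address is replaced by its absolute value. *)
Fixpoint expr_val (s : store) (e : expr) : int :=
  match e with
  | Const z => z
  | Read a e1 => s a `|expr_val s e1|%N
  | Bin o e1 e2 => binop_val o (expr_val s e1) (expr_val s e2)
  end.

Fixpoint expr_time (s : store) (e : expr) : nat :=
  match e with
  | Const z => nbits z
  | Read a e1 =>
      (expr_time s e1 + nbits (expr_val s e1) + nbits (expr_val s e))%N
  | Bin o e1 e2 =>
      (expr_time s e1 + expr_time s e2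
         + nbits (expr_val s e1) + nbits (expr_val s e2))%N
  end.

Definition update (s : store) (a i : nat) (v : int) : store :=
  fun b k => if (b == a) && (k == i) then v else s b k.

(* exec c s t s': started in s, c halts in s' after time t.  A test succeeds
   when the tested expression is positive. *)
Inductive exec : cmd -> store -> nat -> store -> Prop :=
  | ExecSkip s : exec Skip s 1 s
  | ExecWrite a e1 e2 s :
      exec (Write a e1 e2) s
        (expr_time s e1 + expr_time s e2
           + nbits (expr_val s e1) + nbits (expr_val s e2))%N
        (update s a `|expr_val s e1|%N (expr_val s e2))
  | ExecSeq c1 c2 s s1 s2 t1 t2 :
      exec c1 s t1 s1 -> exec c2 s1 t2 s2 ->
      exec (Seq c1 c2) s (t1 + t2)%N s2
  | ExecIfTrue e c1 c2 s s1 t1 :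
      0 < expr_val s e -> exec c1 s t1 s1 ->
      exec (If e c1 c2) s (expr_time s e + t1)%N s1
  | ExecIfFalse e c1 c2 s s1 t1 :
      expr_val s e <= 0 -> exec c2 s t1 s1 ->
      exec (If e c1 c2) s (expr_time s e + t1)%N s1
  | ExecWhileTrue e c s s1 s2 t1 t2 :
      0 < expr_val s e -> exec c s t1 s1 -> exec (While e c) s1 t2 s2 ->
      exec (While e c) s (expr_time s e + t1 + t2)%N s2
  | ExecWhileFalse e c s :
      expr_val s e <= 0 -> exec (While e c) s (expr_time s e) s.

Definition tabulate (n : nat) (f : 'I_n -> int) (i : nat) : int :=
  oapp f 0 (insub i).

Section Encoding.

Variables (m p q : nat) (I : mkpc rat m p q).

Definition encode : store := fun a i =>
  match a with
  | 0%N => nth 0 [:: m%:Z; p%:Z; q%:Z] i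
  | 1%N => tabulate (fun j => numq (profit I j)) i
  | 2%N => tabulate (fun j => denq (profit I j)) i
  | 3%N => tabulate (fun j => numq (cost I j)) i
  | 4%N => tabulate (fun j => denq (cost I j)) i
  | 5%N => tabulate (fun k => numq (capa I k)) i
  | 6%N => tabulate (fun k => denq (capa I k)) i
  | 7%N => tabulate (fun k => (clus I k : nat)%:Z) i
  | 8%N => tabulate (fun l => numq (ucap I l)) i
  | 9%N => tabulate (fun l => denq (ucap I l)) i
  | _ => 0
  end.

Definition rat_bits (r : rat) : nat := (nbits (numq r) + nbits (denq r))%N.

(* The total number of bits of the encoded instance. *)
Definition input_size : nat :=
  (nbits m%:Z + nbits p%:Z + nbits q%:Z
   + \sum_(j < m) (rat_bits (profit I j) + rat_bits (cost I j))
   + \sum_(k < p) (rat_bits (capa I k) + nbits (clus I k : nat)%:Z)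
   + \sum_(l < q) rat_bits (ucap I l))%N.

(* A rational matrix is stored row by row, the numerators in array a and the
   denominators in array a + 1; fractions need not be reduced. *)
Definition stores_mx (s : store) (a : nat) (x : 'M[rat]_(m, p)) : Prop :=
  forall (j : 'I_m) (k : 'I_p),
    s a.+1 (j * p + k)%N != 0 /\
    x j k = (s a (j * p + k)%N)%:~R / (s a.+1 (j * p + k)%N)%:~R.

Record stores_run (s : store) (pi : 'I_p -> nat) (xopt x : 'M[rat]_(m, p))
    (M : {set 'I_m * 'I_p}) (y : 'M[rat]_(m, p)) : Prop := StoresRun {
  stores_pi : forall k : 'I_p, s 10 k = (pi k)%:Z;
  stores_xopt : stores_mx s 11 xopt;
  stores_x : stores_mx s 13 x;
  stores_M : forall (j : 'I_m) (k : 'I_p),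
    s 15 (j * p + k)%N = ((j, k) \in M)%:Z;
  stores_y : forall (j : 'I_m) (k : 'I_p),
    (s 16 (j * p + k)%N)%:~R = y j k
}.

End Encoding.

(* The program c, on every valid rational instance, carries out a run of the
   algorithm, leaving all its intermediate results in memory, within time
   bounded in terms of the bit size of the instance. *)
Definition implements_algorithm2 (c : cmd) (bound : nat -> nat) : Prop :=
  forall (m p q : nat) (I : mkpc rat m p q), mkpc_valid I ->
  exists (t : nat) (s : store),
    [/\ exec c (encode I) t s,
        (t <= bound (input_size I))%N &
        exists (pi : 'I_p -> nat) (xopt x : 'M[rat]_(m, p))
               (M : {set 'I_m * 'I_p}) (y : 'M[rat]_(m, p)),
          algorithm2_run I pi xopt x M y /\ stores_run s pi xopt x M y].

(* Main.v *)
(** Approximation.  Relaxing the bounds [B_k] to the shares [U_l z*_k] loses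
    nothing: in every cluster the shares fill the largest knapsacks first, so
    for each threshold [b] the items of cost at least [b] of any feasible
    assignment fit in the total share of the knapsacks of capacity at least
    [b], and fractional items may be moved to larger knapsacks.  The value of
    the linear program splits over the three candidates, because a fractional
    item has exactly one edge in the matching.

    Running time.  After the substitution [d_j = c_j sum_k x_jk] the linear
    program is a transportation problem whose feasible region is described by
    the nested constraints [sum_(c_t >= c_i) d_t <= sum_(B_k >= c_i) U z*_k].
    These form a polymatroid, so filling the items by decreasing density is
    optimal, and [d] is a difference of two values of the rank function, which
    is a minimum of finitely many sums.  Laying items and knapsacks on a line
    by decreasing size turns [d] into an optimal [x] that already has the
    bounded split property: two truncated items are always separated by a
    tight threshold.  The resulting closed formulas are evaluated by a program
    in which each array is the fold of an arithmetic expression over earlier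
    arrays, for which polynomial time is automatic. *)

Require Import Defs.
From mathcomp Require Import all_boot all_order all_algebra.
From mathcomp Require Import ring lra zify.

Set Implicit Arguments.
Unset Strict Implicit.
Unset Printing Implicit Defensive.

Import Order.TTheory GRing.Theory Num.Theory.
Local Open Scope ring_scope.

(** * Ranks and telescoping *)

(** The second half of the theorem asks for one program and one polynomial, with exact rational
    results and every bit charged. A fixed number of closed formulas keeps number sizes under
    control: each enlarges bit lengths by a polynomial, and finitely many polynomials compose to a
    polynomial. The reduction to the amounts [d] works because the knapsacks open to an item form a
    nested family, so a Hall condition has to be checked only at the costs of items. The layout on
    the line serves both halves: it turns the costs of an optimal assignment into a solution of the
    linear program, which bounds [OPT], and it turns the greedy amounts into the optimum that is
    computed. The run exhibited uses this one matrix both as the optimum and as the solution derived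
    from it. The delicate point is the matching: an item truncated inside a single knapsack has no
    other choice, which pushes the next item to its last knapsack, and so on up to a threshold where
    items and knapsacks end together; a second truncated item met before that could find its only
    knapsack taken. *)

Section Rank.

Variables (T : finType) (r : T -> nat).
Hypothesis r_inj : injective r.

(** Ranks may leave gaps, so a level can be empty. Quantifying over [V] and [F] inside the
    disjunction lets one case distinction rewrite sums of several functions. *)
Lemma big_rank_step (N : nat) :
  (forall (V : nmodType) (F : T -> V),
     \sum_(k | (r k < N.+1)%N) F k = \sum_(k | (r k < N)%N) F k) \/
  exists2 k0, r k0 = N & forall (V : nmodType) (F : T -> V),
     \sum_(k | (r k < N.+1)%N) F k = \sum_(k | (r k < N)%N) F k + F k0.
Proof.
case: (pickP (fun k => r k == N)) => [k0 /eqP rk0|no]; [right|left].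
  exists k0 => // V F; rewrite (bigD1 k0) /= ?rk0 // addrC; congr (_ + _).
  apply: eq_bigl => k; rewrite ltnS ltn_neqAle andbC; congr (_ && _).
  by rewrite -rk0 (inj_eq r_inj).
move=> V F; apply: eq_bigl => k; rewrite ltnS leq_eqVlt.
by move: (no k) => /= ->.
Qed.

Lemma big_rank_all (V : nmodType) (F : T -> V) :
  \sum_(k | (r k < (\max_k r k).+1)%N) F k = \sum_k F k.
Proof. by apply: eq_bigl => k; rewrite ltnS leq_bigmax. Qed.

Lemma telescope_rank (R V : zmodType) (C : T -> R) (F : R -> V) :
  \sum_k (F (\sum_(t | (r t < r k)%N) C t + C k)
          - F (\sum_(t | (r t < r k)%N) C t)) = F (\sum_k C k) - F 0.
Proof.
rewrite -[LHS]big_rank_all -[\sum_k C k]big_rank_all.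
elim: (\max_k r k).+1 => [|N IH]; first by rewrite !big_pred0 ?subrr.
have [E|[k0 rk0 E]] := big_rank_step N; first by rewrite !E.
by rewrite !E IH rk0 addrC addrA subrK.
Qed.

(* Abel summation. *)
Lemma sum_rank_ge0 (R : realDomainType) (w e : T -> R) :
  (forall j, 0 <= w j) -> (forall i j, (r i <= r j)%N -> w j <= w i) ->
  (forall j, 0 <= \sum_(t | (r t <= r j)%N) e t) ->
  0 <= \sum_j w j * e j.
Proof.
move=> w_ge0 w_noninc pre; rewrite -big_rank_all.
set N := (_).+1.
(* The induction varies a lower bound [v] of the weights: at a new element it is raised to the
   weight of that element, which is sound because the new prefix sum is nonnegative. The claim is
   the case [v = 0]. *)
suff H : forall v, 0 <= v -> (forall j, (r j < N)%N -> v <= w j) ->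
   v * (\sum_(j | (r j < N)%N) e j) <= \sum_(j | (r j < N)%N) w j * e j.
  by have := H 0 (lexx 0) (fun j _ => w_ge0 j); rewrite mul0r.
elim: N => [|N IH] v v0 vw; first by rewrite !big_pred0 ?mulr0.
have [E|[k0 rk0 E]] := big_rank_step N; rewrite !E.
  by apply: IH => // j jN; apply: vw; apply: ltnW.
have := pre k0; under eq_bigl do rewrite rk0 -ltnS.
rewrite E => S0.
apply: (@le_trans _ _ (w k0 * (\sum_(j | (r j < N)%N) e j + e k0))).
  by apply: ler_wpM2r => //; apply: vw; rewrite rk0.
rewrite mulrDr lerD2r; apply: IH => // j jN.
by apply: w_noninc; rewrite rk0 ltnW.
Qed.

End Rank.

(** * Decreasing order with ties broken by index *)

Section Precedence.

Variables (R : realDomainType) (n : nat) (v : 'I_n -> R).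

Definition prec (i j : 'I_n) : bool :=
  (v j < v i) || (v i == v j) && (i < j)%N.

Lemma precxx i : prec i i = false.
Proof. by rewrite /prec ltxx ltnn andbF. Qed.

Lemma prec_trans : transitive prec.
Proof.
move=> j i k /orP[ij|/andP[/eqP ij lij]] /orP[jk|/andP[/eqP jk ljk]].
- by rewrite /prec (lt_trans jk ij).
- by rewrite /prec -jk ij.
- by rewrite /prec ij jk.
by rewrite /prec ij jk eqxx (ltn_trans lij ljk) orbT.
Qed.

Lemma prec_total i j : i != j -> prec i j || prec j i.
Proof.
rewrite /prec => nij; case: ltgtP => //= _.
by rewrite -neq_ltn.
Qed.

Lemma prec_le i j : prec i j -> v j <= v i.
Proof. by case/orP => [/ltW //|/andP[/eqP -> _]]. Qed.

Lemma lt_prec i j : v j < v i -> prec i j.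
Proof. by rewrite /prec => ->. Qed.

Variables (X : eqType) (e : 'I_n -> X).

(** The key [e] groups the indices: clusters give positions inside a cluster, a constant key gives a
    global rank. *)
Definition rank (i : 'I_n) : nat := #|[set t | (e t == e i) && prec t i]|.

Lemma rank_lt i j : e i = e j -> (rank i < rank j)%N = prec i j.
Proof.
have up : forall a b, e a = e b -> prec a b -> (rank a < rank b)%N.
  move=> a b eab pab; apply: proper_card; apply/properP; split.
    apply/subsetP => t; rewrite !inE eab => /andP[-> /=] pta.
    exact: prec_trans pta pab.
  by exists a; rewrite !inE ?eab ?eqxx ?pab ?precxx.
move=> eij; apply/idP/idP => [rij|]; last exact: up.
have [eq_ij|nij] := eqVneq i j; first by rewrite eq_ij ltnn in rij.
case/orP: (prec_total nij) => // pji.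
by have := up _ _ (esym eij) pji; lia.
Qed.

Lemma rank_inj i j : e i = e j -> rank i = rank j -> i = j.
Proof.
move=> eij rij; apply/eqP; apply: contraT => nij.
by case/orP: (prec_total nij); rewrite -rank_lt ?rij ?ltnn.
Qed.

Lemma rank_le i j : e i = e j -> (rank i <= rank j)%N -> v j <= v i.
Proof.
move=> eij; rewrite leqNgt rank_lt // => nji.
by rewrite leNgt; apply: contra nji => ?; apply: lt_prec.
Qed.

End Precedence.

(** * Overlap of two intervals *)

Section Clamp.

Variable R : realDomainType.
Implicit Types a b e v : R.

Definition clamp a b v : R := Num.max a (Num.min b v).

Definition overlap a b e e' : R :=
  Num.max 0 (Num.min b e' - Num.max a e).

(** As an increment of the single function [clamp a b], the overlap telescopes when [[e, e']] runs
    through consecutive segments. *)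
Lemma overlapE a b e e' :
  a <= b -> e <= e' -> overlap a b e e' = clamp a b e' - clamp a b e.
Proof.
move=> ab ee; rewrite /overlap /clamp.
case: (leP b e) => be.
  rewrite (min_l (le_trans be ee)) (max_r (le_trans ab be)) subrr.
  by rewrite max_l ?subr_le0.
case: (leP b e') => be'; last first.
  case: (leP a e') => ae'; last first.
    rewrite max_l ?subr_le0 ?le_max ?(ltW ae') //.
    by rewrite (max_l (le_trans ee (ltW ae'))) subrr.
  by rewrite max_r // subr_ge0 ge_max ae'.
by rewrite (max_r ab) max_r // subr_ge0 ge_max ab ltW.
Qed.

Lemma overlapC a b e e' : overlap a b e e' = overlap e e' a b.
Proof. by rewrite /overlap minC maxC [Num.max e a]maxC maxC. Qed.

End Clamp.

(** * Greedy filling of a nested capacity system *)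

Section Greedy.

Variables (R : realDomainType) (T : finType) (r : T -> nat) (c Cap : T -> R).
Hypothesis r_inj : injective r.
Hypothesis c_ge0 : forall j, 0 <= c j.
Hypothesis Cap_ge0 : forall i, 0 <= Cap i.

(** An upper bound on the total that feasible amounts can reach on [A]: items at or above the
    threshold of [i] share [Cap i], smaller ones are limited by their own [c]. [None] uses the
    individual limits only. As the constraints are nested, one threshold at a time is enough. *)
Definition cut (o : option T) (A : pred T) : R :=
  if o is Some i then Cap i + \sum_(t | A t && (c t < c i)) c t
  else \sum_(t | A t) c t.

Definition greedy_rank (A : pred T) : R :=
  \big[Num.min/cut None A]_(i : T) cut (Some i) A.

Lemma greedy_rank_le A o : greedy_rank A <= cut o A.
Proof.
rewrite /greedy_rank; case: o => [i|]; first exact: bigmin_le.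
exact: bigmin_le_id.
Qed.

Lemma greedy_rank_attained A : exists o, greedy_rank A = cut o A.
Proof.
rewrite /greedy_rank; elim/big_ind: _ => [|x y [o ->] [o' ->]|i _].
- by exists None.
- by case: (leP (cut o A) (cut o' A)) => _; [exists o|exists o'].
by exists (Some i).
Qed.

Lemma eq_greedy_rank A B : A =1 B -> greedy_rank A = greedy_rank B.
Proof.
move=> AB; rewrite /greedy_rank.
have E o : cut o A = cut o B.
  by case: o => [i|] /=; [congr (_ + _)|]; apply: eq_bigl => t; rewrite AB.
by rewrite E; under eq_bigr do rewrite E.
Qed.

Definition counted (o : option T) (j : T) : bool :=
  if o is Some i then c j < c i else true.

Lemma cut_add o A j : ~~ A j ->
  cut o (predU1 j A) = cut o A + (if counted o j then c j else 0).
Proof.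
move=> nAj; case: o => [i|] /=; last first.
  rewrite (bigD1 j) /= ?eqxx // addrC; congr (_ + _); apply: eq_bigl => t.
  by case: eqVneq => [->|_]; rewrite ?(negPf nAj) ?andbT ?andbF.
rewrite -addrA; congr (_ + _); case: ifP => ji; last first.
  rewrite addr0; apply: eq_bigl => t; case: eqVneq => //= ->.
  by rewrite ji andbF.
rewrite (bigD1 j) /= ?eqxx ?ji // addrC; congr (_ + _); apply: eq_bigl => t.
by case: eqVneq => [->|_]; rewrite ?(negPf nAj) ?andbT ?andbF.
Qed.

Lemma greedy_rank_add A j : ~~ A j ->
  greedy_rank A <= greedy_rank (predU1 j A) <= greedy_rank A + c j.
Proof.
move=> nAj; apply/andP; split.
  have [o ->] := greedy_rank_attained (predU1 j A).
  rewrite cut_add //; apply: (le_trans (greedy_rank_le A o)).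
  by rewrite lerDl; case: ifP.
have [o ->] := greedy_rank_attained A.
apply: (le_trans (greedy_rank_le _ o)); rewrite cut_add // lerD2l.
by case: ifP.
Qed.

(** Thresholds are totally ordered. In the only hard case the best cut of [A] counts [j] and the
    best cut of [B] with [j] does not, so the latter has the lower threshold; exchanging the two
    cuts changes the total only on the band between the thresholds, where [A] has at least the items
    of [B]. *)
Lemma greedy_rank_submod (A B : pred T) j : subpred B A -> ~~ A j ->
  greedy_rank (predU1 j A) + greedy_rank B
    <= greedy_rank A + greedy_rank (predU1 j B).
Proof.
move=> BA nAj; have nBj : ~~ B j by apply: contra nAj; apply: BA.
have [o2 ->] := greedy_rank_attained A.
have [o1 ->] := greedy_rank_attained (predU1 j B).
have leA := greedy_rank_le (predU1 j A); have leB := greedy_rank_le B.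
have cj := c_ge0 j.
case j2 : (counted o2 j); last first.
  have := leA o2; have := leB o1; rewrite !cut_add // j2.
  by case: ifP => _; lra.
case j1 : (counted o1 j).
  by have := leA o2; have := leB o1; rewrite !cut_add // j2 j1; lra.
have := leA o1; have := leB o2; rewrite !cut_add // j1 !addr0.
case: o1 j1 {leA leB} => [i1|//] /= j1 l2 l1.
apply: (le_trans (lerD l1 l2)).
(* the cuts [o1] and [o2] are nested, so they can be uncrossed *)
pose inc (X : pred T) := \sum_(t | X t && ((c i1 <= c t) && counted o2 t)) c t.
have split (X : pred T) :
   cut o2 X = (if o2 is Some i then Cap i else 0)
              + (\sum_(t | X t && (c t < c i1)) c t + inc X).
  rewrite /inc; case: o2 j2 {l1 l2 inc} => [i2|_] /=.
    move=> j2; congr (_ + _); rewrite (bigID (fun t => c t < c i1)) /=.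
    congr (_ + _); apply: eq_bigl => t; rewrite -?andbA; congr (_ && _).
      case: (ltP (c t) (c i1)) => //= t1; rewrite ?andbT ?andbF //.
      by rewrite (lt_trans t1) // (le_lt_trans _ j2) // leNgt j1.
    by rewrite -leNgt andbC.
  rewrite add0r (bigID (fun t => c t < c i1)) /=; congr (_ + _).
  by apply: eq_bigl => t; rewrite andbT -leNgt.
have : inc B <= inc A.
  rewrite /inc big_mkcond [leRHS]big_mkcond; apply: ler_sum => t _.
  case Bt: (B t); first by rewrite (BA t Bt).
  by rewrite /=; case: ifP.
by rewrite !split; lra.
Qed.

Definition below (N : nat) : pred T := fun t => (r t < N)%N.

(** The marginals of the rank function along [r]: the vertex that Edmonds' greedy algorithm finds in
    a polymatroid. *)
Definition greedy (j : T) : R :=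
  greedy_rank (below (r j).+1) - greedy_rank (below (r j)).

Lemma below_add j : below (r j).+1 =1 predU1 j (below (r j)).
Proof.
by move=> t; rewrite /below /= ltnS leq_eqVlt (inj_eq r_inj).
Qed.

Lemma greedyE j :
  greedy j = greedy_rank (predU1 j (below (r j))) - greedy_rank (below (r j)).
Proof. by rewrite /greedy (eq_greedy_rank (below_add j)). Qed.

Lemma greedy_bounds j : 0 <= greedy j <= c j.
Proof.
rewrite greedyE.
have nj : ~~ below (r j) j by rewrite /below ltnn.
have := greedy_rank_add nj; lra.
Qed.

Lemma greedy_rank0 (A : pred T) : A =1 xpred0 -> greedy_rank A = 0.
Proof.
move=> A0; apply/eqP; rewrite eq_le; apply/andP; split.
  have := greedy_rank_le A None; by rewrite /= big_pred0.
have [o ->] := greedy_rank_attained A; case: o => [i|] /=.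
  by rewrite big_pred0 ?addr0 // => t; rewrite A0.
by rewrite big_pred0.
Qed.

Lemma below_step N : below N.+1 =1 below N \/
  exists2 j, r j = N & below N.+1 =1 predU1 j (below N).
Proof.
case: (pickP (fun k => r k == N)) => [j /eqP rj|no]; [right|left].
  by exists j => // t; rewrite -rj below_add.
by move=> t; rewrite /below ltnS leq_eqVlt; move: (no t) => /= ->.
Qed.

Lemma sum_predU1 (F : T -> R) (A : pred T) j : ~~ A j ->
  \sum_(t | predU1 j A t) F t = F j + \sum_(t | A t) F t.
Proof.
move=> nAj; rewrite (bigD1 j) /= ?eqxx //; congr (_ + _); apply: eq_bigl => t.
by case: eqVneq => [->|_]; rewrite ?(negPf nAj) ?andbT ?andbF.
Qed.

Lemma sum_greedy N : \sum_(t | below N t) greedy t = greedy_rank (below N).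
Proof.
elim: N => [|N IH]; first by rewrite big_pred0 ?greedy_rank0.
have [E|[j rj E]] := below_step N.
  by rewrite (eq_bigl _ _ E) IH (eq_greedy_rank E).
have nj : ~~ below N j by rewrite /below rj ltnn.
by rewrite (eq_bigl _ _ E) sum_predU1 // IH greedyE rj (eq_greedy_rank E) subrK.
Qed.

(** By submodularity, the increment of an item over all earlier items is at most its increment over
    the earlier items above the threshold. The latter add up to the rank of the items above the
    threshold, and the cut at [i] of that set is just [Cap i]. *)
Lemma sum_greedy_chain i : \sum_(t | c i <= c t) greedy t <= Cap i.
Proof.
suff H N : \sum_(t | below N t) (if c i <= c t then greedy t else 0)
    <= greedy_rank (fun t => below N t && (c i <= c t)).
  rewrite big_mkcond -(big_rank_all r); apply: (le_trans (H _)).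
  apply: (le_trans (greedy_rank_le _ (Some i))) => /=.
  rewrite big_pred0 ?addr0 // => t.
  by rewrite -andbA; case: (leP (c i)); rewrite ?andbF.
elim: N => [|N IH].
  by rewrite big_pred0 ?greedy_rank0.
have [E|[j rj E]] := below_step N; rewrite (eq_bigl _ _ E).
  apply: (le_trans IH); rewrite le_eqVlt; apply/orP; left; apply/eqP.
  by apply: eq_greedy_rank => t; rewrite E.
have nj : ~~ below N j by rewrite /below rj ltnn.
rewrite sum_predU1 //; case: ifP => [ij|nij]; last first.
  rewrite add0r; apply: (le_trans IH).
  rewrite le_eqVlt; apply/orP; left; apply/eqP.
  by apply: eq_greedy_rank => t; rewrite E /=; case: eqVneq => //= ->;
     rewrite nij andbF.
rewrite greedyE rj.
set B := (fun t => _ && _) in IH.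
have BA : subpred B (below N) by move=> t /andP[].
have := greedy_rank_submod BA nj.
rewrite [X in _ -> _ <= X](_ : _ = greedy_rank (predU1 j B)); first by lra.
by apply: eq_greedy_rank => t; rewrite E /= /B; case: eqVneq => //= ->.
Qed.

(* A truncated item is blocked by a threshold that is already tight for the
   items ranked up to it. *)
Lemma greedy_tight a : greedy a < c a -> exists2 i, c i <= c a &
  \sum_(t | (r t <= r a)%N && (c i <= c t)) greedy t = Cap i.
Proof.
rewrite greedyE => la; set A := below (r a) in la.
have nA : ~~ A a by rewrite /A /below ltnn.
have [o eo] := greedy_rank_attained (predU1 a A).
(* A minimal cut counting [a] would have risen by the full [c a], leaving [a] untruncated. *)
have la' : ~~ counted o a.
  apply/negP => oa; move: la; rewrite eo cut_add // oa.
  by have := greedy_rank_le A o; lra.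
case: o eo la' => [i|//] /= eo; rewrite -leNgt => ia; exists i => //.
have S : \sum_(t | (r t <= r a)%N) greedy t
       = Cap i + \sum_(t | (r t <= r a)%N && (c t < c i)) c t.
  rewrite -[LHS]/(\sum_(t | below (r a).+1 t) greedy t) sum_greedy.
  rewrite (eq_greedy_rank (below_add a)) eo; congr (_ + _).
  apply: eq_bigl => t; congr (_ && _).
  by rewrite [LHS]/= -[RHS]/(below (r a).+1 t) below_add.
apply/eqP; rewrite eq_le; apply/andP; split.
  apply: le_trans (sum_greedy_chain i).
  rewrite big_mkcond [leRHS]big_mkcond; apply: ler_sum => t _.
  case: (c i <= c t); rewrite ?andbF ?andbT //; case: ifP => // _.
  by case/andP: (greedy_bounds t).
(* Items below the threshold take at most their own [c], so those above must already take all of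
   [Cap i]. *)
move: S; rewrite (bigID (fun t => c i <= c t)) /= => S.
have : \sum_(t | (r t <= r a)%N && ~~ (c i <= c t)) greedy t
    <= \sum_(t | (r t <= r a)%N && (c t < c i)) c t.
  under eq_bigl do rewrite -ltNge.
  by apply: ler_sum => t _; case/andP: (greedy_bounds t).
by move: S; lra.
Qed.

(** The earlier of the two in rank is blocked by a threshold saturated by the items ranked up to it,
    so the later one, having a positive amount, lies strictly below that threshold. With
    [c b <= c a] this forces [a] to be the earlier. *)
Lemma greedy_separated a b : 0 < greedy a < c a -> 0 < greedy b < c b ->
  c b <= c a -> a <> b -> exists2 i, c b < c i <= c a &
  \sum_(t | c i <= c t) greedy t = Cap i.
Proof.
have aux x y : greedy x < c x -> 0 < greedy y -> (r x < r y)%N ->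
   exists i, [/\ c i <= c x, c y < c i &
     \sum_(t | c i <= c t) greedy t = Cap i].
  move=> ltx gty xy; have [i ix Ei] := greedy_tight ltx.
  have := sum_greedy_chain i; rewrite -Ei => le.
  have ge0 (P : pred T) : 0 <= \sum_(t | P t) greedy t.
    by apply: sumr_ge0 => t _; case/andP: (greedy_bounds t).
  have sp : \sum_(t | c i <= c t) greedy t =
    \sum_(t | (r t <= r x)%N && (c i <= c t)) greedy t +
    \sum_(t | (c i <= c t) && ~~ (r t <= r x)%N) greedy t.
    rewrite (bigID (fun t => (r t <= r x)%N)) /=; congr (_ + _).
    by apply: eq_bigl => t; rewrite andbC.
  exists i; split => //; last first.
    by apply/eqP; rewrite eq_le -{1}Ei le /= -Ei sp lerDl; exact: ge0.
  rewrite ltNge; apply/negP => iy.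
  have : 0 < \sum_(t | (c i <= c t) && ~~ (r t <= r x)%N) greedy t.
    rewrite (bigD1 y) /= ?iy -?ltnNge // ltr_wpDr // sumr_ge0 //
      => t _; case/andP: (greedy_bounds t).
  by move: le; rewrite sp; lra.
move=> /andP[a0 ac] /andP[b0 bc] ba nab.
have nr : r a != r b by apply/eqP => /r_inj.
case: (ltngtP (r a) (r b)) nr => // rab _.
  by have [i [ia bi Ei]] := aux _ _ ac b0 rab; exists i; rewrite ?bi.
have [i [ib ai Ei]] := aux _ _ bc a0 rab.
by move: ib ai ba; lra.
Qed.

(** Each prefix sum of [greedy] equals the rank of the prefix, which bounds the same prefix sum of
    any feasible [d']; Abel summation transfers this to nonincreasing weights. *)
Lemma greedy_optimal (w d' : T -> R) :
  (forall j, 0 <= w j) -> (forall i j, (r i <= r j)%N -> w j <= w i) ->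
  (forall j, 0 <= d' j <= c j) ->
  (forall i, \sum_(t | c i <= c t) d' t <= Cap i) ->
  \sum_j w j * d' j <= \sum_j w j * greedy j.
Proof.
move=> w0 wm d'b d'c; rewrite -subr_ge0 -sumrB.
under eq_bigr do rewrite -mulrBr.
apply: (sum_rank_ge0 r_inj) => // j; rewrite sumrB subr_ge0.
rewrite -[leRHS]/(\sum_(t | below (r j).+1 t) greedy t) sum_greedy.
have [o ->] := greedy_rank_attained (below (r j).+1).
case: o => [i|] /=; last by apply: ler_sum => t _; case/andP: (d'b t).
rewrite (bigID (fun t => c i <= c t)) /=; apply: lerD.
  apply: le_trans (d'c i); rewrite big_mkcond [leRHS]big_mkcond.
  apply: ler_sum => t _; case: (c i <= c t); rewrite ?andbF ?andbT //.
  by case: ifP => // _; case/andP: (d'b t).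
under eq_bigl do rewrite -ltNge.
by apply: ler_sum => t _; case/andP: (d'b t).
Qed.

End Greedy.

(** * Staircase layout *)

Section Start.

Variables (R : realDomainType) (n : nat) (v w : 'I_n -> R).
Hypothesis w_ge0 : forall i, 0 <= w i.

Definition start (i : 'I_n) : R := \sum_(t | prec v t i) w t.

Lemma start_ge0 i : 0 <= start i.
Proof. exact: sumr_ge0. Qed.

Lemma start_mono i j : prec v i j -> start i + w i <= start j.
Proof.
move=> ij; rewrite /start [leRHS](bigD1 i) //= [leRHS]addrC lerD2r.
rewrite big_mkcond [leRHS]big_mkcond; apply: ler_sum => t _.
case: ifP => [ti|_]; last by case: ifP.
rewrite (prec_trans ti ij); case: eqVneq => // eti.
by rewrite eti precxx in ti.
Qed.

Lemma end_le_sum (P : pred 'I_n) i :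
  P i -> (forall t, prec v t i -> P t) -> start i + w i <= \sum_(t | P t) w t.
Proof.
move=> Pi Pt; rewrite (bigD1 i) //= [leRHS]addrC lerD2r /start.
rewrite big_mkcond [leRHS]big_mkcond; apply: ler_sum => t _.
case: ifP => [ti|_]; last by case: ifP.
rewrite (Pt t ti) /=; case: eqVneq => // eti.
by rewrite eti precxx in ti.
Qed.

Lemma sum_le_start (P : pred 'I_n) i :
  (forall t, P t -> prec v t i) -> \sum_(t | P t) w t <= start i.
Proof.
move=> Pt; rewrite /start big_mkcond [leRHS]big_mkcond.
by apply: ler_sum => t _; case: ifP => [/Pt ->|_] //; case: ifP.
Qed.

(** The segments tile the interval from 0 to the total. With [F] a clamp this measures overlaps;
    with [F] the indicator of a half-line it finds the segment holding a given point. *)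
Lemma telescope_start (V : zmodType) (F : R -> V) :
  \sum_i (F (start i + w i) - F (start i)) = F (\sum_i w i) - F 0.
Proof.
have r_inj : injective (rank v (fun _ : 'I_n => tt)).
  by move=> i j; apply: rank_inj.
rewrite -(telescope_rank r_inj w F); apply: eq_bigr => i _.
by rewrite /start (eq_bigl _ _ (fun t => rank_lt v (erefl : tt = tt))).
Qed.

(** The indicator of [e <= z] jumps between 0 and the total, hence across some segment. A shared
    endpoint goes here to the earlier nonempty segment, in [locate_right] to the later one: the last
    knapsack met by an item and the first one need opposite conventions. *)
Lemma locate_left (e : R) : 0 < e <= \sum_i w i ->
  exists i, start i < e <= start i + w i.
Proof.
move=> /andP[e0 es].
have : \sum_i (((e <= start i + w i)%R : nat)%:R - ((e <= start i)%R : nat)%:R) != 0 :> R.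
  by rewrite (telescope_start (fun z : R => ((e <= z)%R : nat)%:R)) es leNgt e0 subr0 oner_eq0.
case: (pickP (fun i => start i < e <= start i + w i)) => [i|no]; first by exists i.
rewrite big1 ?eqxx // => i _; move: (no i); rewrite ltNge /=.
case: leP => /= [ei _|_ /= ->]; last by rewrite subrr.
by rewrite (le_trans ei) ?subrr // lerDl.
Qed.

Lemma locate_right (e : R) : 0 <= e < \sum_i w i ->
  exists i, start i <= e < start i + w i.
Proof.
move=> /andP[e0 es].
have : \sum_i (((e < start i + w i)%R : nat)%:R - ((e < start i)%R : nat)%:R) != 0 :> R.
  by rewrite (telescope_start (fun z : R => ((e < z)%R : nat)%:R)) es ltNge e0 subr0 oner_eq0.
case: (pickP (fun i => start i <= e < start i + w i)) => [i|no]; first by exists i.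
rewrite big1 ?eqxx // => i _; move: (no i); rewrite leNgt /=.
case: ltP => /= [ei _|_ /= ->]; last by rewrite subrr.
by rewrite (lt_le_trans ei) ?subrr // lerDl.
Qed.

End Start.

Section Staircase.

Variables (R : realDomainType) (m p : nat).
Variables (c d : 'I_m -> R) (B C : 'I_p -> R).
Hypothesis d_ge0 : forall j, 0 <= d j.
Hypothesis C_ge0 : forall k, 0 <= C k.

Definition room (b : R) : R := \sum_(k | b <= B k) C k.

Hypothesis chain : forall i, \sum_(t | c i <= c t) d t <= room (c i).

(* Items and knapsacks are laid out on a line by decreasing size, item [j]
   over a segment of length [d j] and knapsack [k] of length [C k]. *)
Definition stair (j : 'I_m) (k : 'I_p) : R :=
  overlap (start c d j) (start c d j + d j) (start B C k) (start B C k + C k).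

Lemma stair_ge0 j k : 0 <= stair j k.
Proof. by rewrite /stair /overlap le_max lexx. Qed.

Lemma stair_gt0 j k : (0 < stair j k) =
  [&& start c d j < start B C k + C k, start B C k < start c d j + d j,
      0 < d j & 0 < C k].
Proof.
rewrite /stair /overlap lt_max ltxx /= subr_gt0 lt_min !gt_max !ltrDl.
by case: (0 < d j); case: (0 < C k); case: (start c d j < _); case: (start B C k < _).
Qed.

Lemma end_le_room i j : c i <= c j -> start c d j + d j <= room (c i).
Proof.
move=> ij; apply: le_trans (chain i); apply: end_le_sum => // t /prec_le.
exact: le_trans.
Qed.

Lemma room_le_sum b : room b <= \sum_k C k.
Proof.
rewrite /room big_mkcond; apply: ler_sum => k _.
by case: ifP.
Qed.

Lemma room_le_start b k : B k < b -> room b <= start B C k.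
Proof.
move=> kb; apply: sum_le_start => // t bt; apply: lt_prec.
exact: lt_le_trans kb bt.
Qed.

Lemma end_le_room_knapsack b k : b <= B k -> start B C k + C k <= room b.
Proof.
by move=> bk; apply: end_le_sum => // t /prec_le; apply: le_trans.
Qed.

Lemma sum_stair_row j : \sum_k stair j k = d j.
Proof.
have s0 := start_ge0 c d_ge0 j; have dj := d_ge0 j.
have le := le_trans (end_le_room (lexx (c j))) (room_le_sum _).
under eq_bigr => k _ do rewrite /stair overlapE ?lerDl //.
rewrite telescope_start /clamp (min_l le) max_r ?lerDl //.
by rewrite min_r ?addr_ge0 // max_l //; lra.
Qed.

Lemma sum_stair_col k : \sum_j stair j k <= C k.
Proof.
have s0 := start_ge0 B C_ge0 k; have Ck := C_ge0 k.
under eq_bigr => j _ do rewrite /stair overlapC overlapE ?lerDl //.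
rewrite telescope_start /clamp [Num.min _ 0]min_r ?addr_ge0 // [Num.max _ 0]max_l //.
rewrite lerBlDr [leRHS]addrC ge_max lerDl Ck /=.
by rewrite ge_min lexx.
Qed.

(** By [chain] the segment of [j] ends within [room (c j)], and a knapsack too small for [j] starts
    only after that point. *)
Lemma stair_fit j k : B k < c j -> stair j k = 0.
Proof.
move=> kj; apply/eqP; rewrite eq_le stair_ge0 andbT leNgt stair_gt0.
apply/negP => /and4P[_ lt _ _].
have := le_trans (end_le_room (lexx (c j))) (room_le_start kj).
by rewrite leNgt lt.
Qed.

End Staircase.

(** * Matching in the staircase *)

Section Marks.

Variables (R : realDomainType) (m p : nat).
Variables (c d : 'I_m -> R) (B C : 'I_p -> R).

Definition tight (i : 'I_m) : bool :=
  \sum_(t | c i <= c t) d t == room B C (c i).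

Definition partial (a : 'I_m) : bool := 0 < d a < c a.

Definition late (j : 'I_m) : bool :=
  [exists a, [&& partial a, (a == j) || prec c a j
     & ~~ [exists i, [&& c j < c i, c i <= c a & tight i]]]].

Definition fractional (j : 'I_m) (k : 'I_p) : bool :=
  0 < stair c d B C j k < c j.

(* An item is matched to the first knapsack it meets, unless a truncated item
   comes no later in the same block delimited by tight thresholds: then it is
   matched to the last knapsack it meets. *)
Definition mark (j : 'I_m) (k : 'I_p) : bool :=
  fractional j k &&
  (if late j
   then start B C k < start c d j + d j <= start B C k + C k
   else start B C k <= start c d j < start B C k + C k).

Hypothesis d_bounds : forall j, 0 <= d j <= c j.
Hypothesis C_ge0 : forall k, 0 <= C k.
Hypothesis chain : forall i, \sum_(t | c i <= c t) d t <= room B C (c i).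
Hypothesis separated : forall a b, partial a -> partial b -> prec c a b ->
  exists2 i, c b < c i <= c a & tight i.

Let d_ge0 j : 0 <= d j. Proof. by case/andP: (d_bounds j). Qed.

Lemma mark_fractional j k : mark j k -> fractional j k.
Proof. by case/andP. Qed.

Lemma mark_fun j k k' : mark j k -> mark j k' -> k = k'.
Proof.
case/andP=> _ mk /andP[_ mk']; apply/eqP; apply: contraT => nkk'.
have [/(start_mono C_ge0) H|/(start_mono C_ge0) H] := orP (prec_total B nkk');
  move: mk mk' H; case: ifP => _; lra.
Qed.

Lemma stair_whole j k : start B C k <= start c d j ->
  start c d j + d j <= start B C k + C k -> stair c d B C j k = d j.
Proof.
move=> l1 l2; rewrite /stair /overlap (min_l l2) (max_l l1).
by rewrite max_r; have := d_ge0 j; lra.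
Qed.

(** Sharing [k] forces both items to be late, then [j'] to be truncated inside [k]; this puts two
    truncated items in one block, against [separated]. *)
Lemma mark_inj_prec j j' k : mark j k -> mark j' k -> prec c j j' -> False.
Proof.
move=> /andP[fj mj] /andP[fj' mj'] jj'.
have le := start_mono d_ge0 jj'.
have := fj; rewrite /fractional stair_gt0 => /andP[/and4P[sj ej dj _] jc].
have := fj'; rewrite /fractional stair_gt0 => /andP[/and4P[sj' ej' dj' _] jc'].
(* If [j] is not late, it starts in [k]; as [j'] follows and still meets [k], all of [j] lies in
   [k]. A fractional item inside one knapsack is truncated, so it makes itself late. *)
have lj : late j.
  apply: contraT => nlj; move: mj; rewrite (negPf nlj) => /andP[l1 l2].
  have wj : stair c d B C j k = d j by apply: stair_whole => //; lra.
  case/negP: nlj; apply/existsP; exists j.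
  rewrite /partial dj -wj jc eqxx /=; apply/existsP => -[i].
  by case/and3P=> li gi _; lra.
have [a /and3P[pa aj nt]] := existsP lj.
have aj' : prec c a j'.
  by case/orP: aj => [/eqP ->//|aj]; apply: prec_trans aj jj'.
(* A tight threshold between [j] and [j'] would be a point where an item block and a knapsack block
   both end, and [k] cannot straddle it. *)
have nt' i : c j' < c i -> c i <= c a -> tight i -> False.
  move=> ij' ia ti; case: (ltP (c j) (c i)) => ij.
    by case/negP: nt; apply/existsP; exists i; rewrite ij ia ti.
  have h1 : start c d j + d j <= room B C (c i).
    exact: end_le_room chain _ _ ij.
  have h2 : room B C (c i) <= start c d j'.
    rewrite -(eqP ti); apply: sum_le_start => // t it.
    exact/lt_prec/(lt_le_trans ij').
  case: (leP (c i) (B k)) => ik.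
    have := end_le_room_knapsack C_ge0 ik; lra.
  have := room_le_start C_ge0 ik; lra.
have lj' : late j'.
  apply/existsP; exists a; rewrite pa aj' orbT /=.
  by apply/existsP => -[i /and3P[]]; apply: nt'.
(* Now [j'] ends in [k], and it starts after [j], which also ends in [k]: it lies wholly in [k] and
   is truncated. *)
move: mj mj'; rewrite lj lj' => /andP[m1 m2] /andP[m1' m2'].
have wj' : stair c d B C j' k = d j' by apply: stair_whole => //; lra.
have pj' : partial j' by rewrite /partial dj' -wj' jc'.
have [i /andP[i1 i2] ti] := separated pa pj' aj'.
exact: nt' i1 i2 ti.
Qed.

Lemma mark_inj j j' k : mark j k -> mark j' k -> j = j'.
Proof.
move=> mj mj'; apply/eqP; apply: contraT => njj'.
by case/orP: (prec_total c njj') => [/(mark_inj_prec mj mj')|/(mark_inj_prec mj' mj)].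
Qed.

Lemma mark_exists j k : fractional j k -> exists k', mark j k'.
Proof.
move=> fj; have := fj; rewrite /fractional stair_gt0.
case/andP=> /and4P[sj ej dj _] jc.
have le := le_trans (end_le_room d_ge0 chain (lexx (c j))) (room_le_sum B C_ge0 _).
have s0 := start_ge0 c d_ge0 j.
suff [k' dk' mk'] : exists2 k', 0 < stair c d B C j k' &
   if late j
   then start B C k' < start c d j + d j <= start B C k' + C k'
   else start B C k' <= start c d j < start B C k' + C k'.
  exists k'; rewrite /mark mk' andbT /fractional dk' /=.
  have [->//|nkk'] := eqVneq k' k.
  (* A row total of at most [c j] with a positive part in [k] leaves less than [c j] for [k'], so
     the entry at [k'] is fractional too. *)
  have := sum_stair_row d_ge0 C_ge0 chain j.
  rewrite (bigD1 k) //= (bigD1 k') //= => E.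
  have : 0 < stair c d B C j k by case/andP: fj.
  have : 0 <= \sum_(i | (i != k) && (i != k')) stair c d B C j i.
    by apply: sumr_ge0 => *; apply: stair_ge0.
  by have := d_bounds j; lra.
case: (late j).
  have [|k' /andP[h1 h2]] := @locate_left _ _ B C C_ge0 (start c d j + d j).
    by rewrite le andbT; lra.
  exists k'; rewrite ?h1 ?h2 //; rewrite stair_gt0 h1 dj.
  by apply/and4P; split => //; lra.
have [|k' /andP[h1 h2]] := @locate_right _ _ B C C_ge0 (start c d j).
  by rewrite s0; lra.
exists k'; rewrite ?h1 ?h2 //; rewrite stair_gt0 h2 dj.
by apply/and4P; split => //; lra.
Qed.

End Marks.

(** * The linear program *)

Section EffectiveCapacity.

Variables (R : realFieldType) (m p q : nat) (I : mkpc R m p q).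
Variable pi : 'I_p -> nat.
Hypothesis vI : mkpc_valid I.
Hypothesis ixpi : indexing I pi.

Local Notation B := (capa I).
Local Notation U k := (ucap I (clus I k)).

Definition used (k : 'I_p) : R :=
  \sum_(t | (clus I t == clus I k) && (pi t < pi k)%N) B t.

Definition eff (k : 'I_p) : R := U k * zstar I pi k.

Lemma sum_upto k :
  \sum_(t | (clus I t == clus I k) && (pi t <= pi k)%N) B t = used k + B k.
Proof.
rewrite (bigD1 k) /= ?eqxx ?leqnn // addrC; congr (_ + _).
apply: eq_bigl => t; case: eqP => //= ct; rewrite ltn_neqAle andbC.
congr (_ && _); congr (~~ _); apply/eqP/eqP => [->//|].
exact: (indexing_inj ixpi ct).
Qed.

Lemma criticalE k :
  critical I pi k = (used k <= U k) && (U k < used k + B k).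
Proof. by rewrite /critical sum_upto. Qed.

Lemma used_mono k t : clus I k = clus I t -> (pi k < pi t)%N ->
  used k + B k <= used t.
Proof.
move=> ckt kt; rewrite -sum_upto /used ckt big_mkcond [leRHS]big_mkcond.
apply: ler_sum => s _; case: eqP => //= cs.
case: ifP => [sk|_]; first by rewrite (leq_ltn_trans sk kt).
by case: ifP => // _; apply/ltW/(capa_gt0 vI).
Qed.

Lemma critical_exists l : exists2 k, clus I k = l & critical I pi k.
Proof.
have [k0 ck0] : exists k, clus I k = l.
  case: (pickP (fun k => clus I k == l)) => [k /eqP|no]; first by exists k.
  have := ucap_lt_sum vI l; rewrite big_pred0 // ltNge.
  by rewrite ltW // (ucap_gt0 vI).
have [k1 /andP[/eqP ck1 uk1]] : exists k, (clus I k == l) && (U k < used k + B k).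
  pose P k := clus I k == l.
  have Pk0 : P k0 by rewrite /P ck0.
  case: (arg_maxnP pi Pk0) => k Pk kmax.
  exists k; rewrite [clus I k == l]Pk (eqP Pk) /= -sum_upto.
  rewrite (eq_bigl _ _ (_ : _ =1 P)) ?(ucap_lt_sum vI) // => t.
  rewrite (eqP Pk) -/(P t); case: (boolP (P t)) => //= Pt; exact: kmax.
(* The critical knapsack is the first one whose prefix overflows the cluster: its predecessor does
   not overflow, which is the other half of the definition. *)
pose Q k := (clus I k == l) && (U k < used k + B k).
have Qk1 : Q k1 by rewrite /Q ck1 eqxx -ck1.
case: (arg_minnP pi Qk1) => k /andP[/eqP ck uk] kmin.
exists k; rewrite // criticalE uk andbT.
pose S t := (clus I t == l) && (pi t < pi k)%N.
case: (pickP S) => [t0 St0|no]; last first.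
  by rewrite /used ck big_pred0 // ltW // (ucap_gt0 vI).
case: (arg_maxnP pi St0) => t /andP[/eqP ct tk] tmax.
have -> : used k = used t + B t.
  rewrite -sum_upto /used ck ct; apply: eq_bigl => s.
  case: eqP => //= cs; apply/idP/idP => [sk|st]; last exact: leq_ltn_trans tk.
  by apply: tmax; rewrite /S cs eqxx.
rewrite leNgt; apply/negP => ut.
have : Q t by rewrite /Q ct eqxx -ck.
by move/kmin; rewrite leqNgt tk.
Qed.

Lemma critical_uniq k t :
  critical I pi k -> critical I pi t -> clus I k = clus I t -> k = t.
Proof.
rewrite !criticalE => /andP[k1 k2] /andP[t1 t2] ckt.
apply: (indexing_inj ixpi ckt); move: k1 k2; rewrite ckt => k1 k2.
case: (ltngtP (pi k) (pi t)) => // kt.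
  by exfalso; have := used_mono ckt kt; lra.
by exfalso; have := used_mono (esym ckt) kt; lra.
Qed.

Lemma before_criticalE k : before_critical I pi k = (used k + B k <= U k).
Proof.
apply/existsP/idP => [[t /and3P[/eqP ct + kt]]|le].
  rewrite criticalE ct => /andP[+ _]; apply: le_trans.
  exact: used_mono.
have [t ct crt] := critical_exists (clus I k); exists t.
rewrite ct eqxx crt /=; move: crt; rewrite criticalE ct => /andP[t1 t2].
case: (ltngtP (pi k) (pi t)) => // kt.
  exfalso; have := used_mono ct kt; have := capa_gt0 vI k; lra.
by move: t2 le; rewrite (indexing_inj ixpi ct (esym kt)) => {kt}; lra.
Qed.

Lemma effE k : eff k =
  if used k + B k <= U k then B k else if used k <= U k then U k - used k else 0.
Proof.
rewrite /eff /zstar before_criticalE criticalE.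
have U0 := ucap_gt0 vI (clus I k); have Un0 := lt0r_neq0 U0.
case: leP => _; first by rewrite mulrC divfK.
rewrite andbT; case: leP => _; last by rewrite mulr0.
rewrite mulrBr mulr1 mulr_sumr; congr (_ - _).
by apply: eq_bigr => t /andP[/eqP -> _]; rewrite mulrC divfK.
Qed.

Lemma eff_ge0 k : 0 <= eff k.
Proof.
rewrite effE; have := capa_gt0 vI k.
case: ifP => [|/negbT]; rewrite -?ltNge; first lra.
by case: ifP => [|/negbT]; rewrite -?ltNge; lra.
Qed.

Lemma eff_le_capa k : eff k <= B k.
Proof.
rewrite effE; have := capa_gt0 vI k.
case: ifP => [|/negbT]; rewrite -?ltNge; first lra.
by case: ifP => [|/negbT]; rewrite -?ltNge; lra.
Qed.

Lemma eff_after_critical k t : clus I k = clus I t -> critical I pi t ->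
  (pi t < pi k)%N -> eff k = 0.
Proof.
move=> ck; rewrite criticalE => /andP[_ t2] tk.
have := used_mono (esym ck) tk; have := capa_gt0 vI k; rewrite effE ck.
case: ifP => [|/negbT]; rewrite -?ltNge; first lra.
by case: ifP => [|/negbT]; rewrite -?ltNge; lra.
Qed.

Lemma eff_critical k : critical I pi k -> eff k = U k - used k.
Proof.
by rewrite effE criticalE => /andP[-> ]; rewrite ltNge => /negPf ->.
Qed.

Lemma eff_before_critical k t : clus I k = clus I t -> critical I pi t ->
  (pi k < pi t)%N -> eff k = B k.
Proof.
move=> ck; rewrite effE criticalE => /andP[t1 _] /(used_mono ck) kt.
by rewrite ck (le_trans kt t1).
Qed.

Lemma sum_eff_le l : \sum_(k | clus I k == l) eff k <= ucap I l.
Proof.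
have [t ct crt] := critical_exists l; rewrite (bigD1 t) ?ct //=.
rewrite eff_critical // ct -lerBrDl opprB addrC subrK /used.
rewrite big_mkcond [leRHS]big_mkcond; apply: ler_sum => k _; rewrite ct.
case: eqP => //= ck; case: eqVneq => [->|nkt] /=; first by rewrite ltnn.
case: (ltngtP (pi k) (pi t)) => kt.
- exact: eff_le_capa.
- by rewrite (eff_after_critical _ crt) // ck.
by case/eqP: nkt; apply: (indexing_inj ixpi); rewrite ?ck.
Qed.

(** If the critical knapsack is smaller than [b], every knapsack of size at least [b] precedes it
    and keeps its full capacity. Otherwise the critical knapsack and all those before it are
    counted, and their shares already exhaust the cluster. *)
Lemma sum_eff_large l b :
  Num.min (ucap I l) (\sum_(k | (clus I k == l) && (b <= B k)) B k)
    <= \sum_(k | (clus I k == l) && (b <= B k)) eff k.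
Proof.
have [t ct crt] := critical_exists l.
case: (leP b (B t)) => bt; last first.
  rewrite ge_min; apply/orP; right; apply: ler_sum => k /andP[/eqP ck bk].
  rewrite (eff_before_critical _ crt) ?ck // ltnNge; apply/negP => tk.
  have := indexing_capa ixpi (etrans ct (esym ck)) tk; lra.
rewrite ge_min; apply/orP; left; rewrite (bigD1 t) ?ct ?eqxx //=.
rewrite eff_critical // ct -lerBlDl opprB addrC subrK /used.
rewrite big_mkcond [leRHS]big_mkcond; apply: ler_sum => k _; rewrite ct.
case: eqP => //= ck; case: (boolP (pi k < pi t)%N) => kt; last first.
  by case: ifP => // _; apply: eff_ge0.
rewrite (le_trans bt) ?(indexing_capa ixpi) ?ck ?(ltnW kt) //=.
case: eqVneq => [ekt|_]; first by rewrite ekt ltnn in kt.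
by rewrite (eff_before_critical _ crt) // ck.
Qed.

Local Notation c := (cost I).

(** The necessity half of the Hall condition: items of cost at least [b] can only use knapsacks of
    capacity at least [b]. The staircase gives sufficiency. *)
Lemma lp_chain x b : lp_feasible I pi x ->
  \sum_(j | b <= c j) c j * \sum_k x j k <= room B eff b.
Proof.
move=> fx; rewrite /room [leRHS]big_mkcond.
apply: (@le_trans _ _ (\sum_k \sum_(j | b <= c j) c j * x j k)).
  rewrite exchange_big /=; apply: ler_sum => j _.
  by rewrite mulr_sumr.
apply: ler_sum => k _; case: (leP b (B k)) => bk.
  apply: le_trans (lp_zstar fx k); rewrite [leRHS](bigID (fun j => b <= c j)) /=.
  rewrite lerDl; apply: sumr_ge0 => j _; apply: mulr_ge0.
    exact/ltW/(cost_gt0 vI).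
  by case/andP: (lp_box fx j k).
rewrite big1 // => j bj; rewrite (lp_fit fx) ?mulr0 //.
exact: lt_le_trans bk bj.
Qed.

Definition stair_mx (d : 'I_m -> R) : 'M[R]_(m, p) :=
  \matrix_(j, k) (stair c d B eff j k / c j).

Section StairSolution.

Variable d : 'I_m -> R.
Hypothesis d_bounds : forall j, 0 <= d j <= c j.
Hypothesis chain : forall i, \sum_(t | c i <= c t) d t <= room B eff (c i).

Let d_ge0 j : 0 <= d j. Proof. by case/andP: (d_bounds j). Qed.

Lemma stair_mx_cost j k : c j * stair_mx d j k = stair c d B eff j k.
Proof. by rewrite mxE mulrC divfK // lt0r_neq0 ?(cost_gt0 vI). Qed.

Lemma stair_mx_row j : \sum_k stair_mx d j k = d j / c j.
Proof.
under eq_bigr do rewrite mxE.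
by rewrite -mulr_suml (sum_stair_row d_ge0 eff_ge0 chain).
Qed.

Lemma stair_mx_feasible : lp_feasible I pi (stair_mx d).
Proof.
have c0 := cost_gt0 vI; have col k : \sum_j c j * stair_mx d j k <= eff k.
  under eq_bigr do rewrite stair_mx_cost.
  exact: (sum_stair_col c B d_ge0 eff_ge0 k).
have row j : \sum_k stair_mx d j k <= 1.
  by rewrite stair_mx_row ler_pdivrMr // mul1r; case/andP: (d_bounds j).
have ge0 j k : 0 <= stair_mx d j k.
  by rewrite mxE divr_ge0 ?stair_ge0 // ltW.
split=> //.
- move=> j k; rewrite ge0 (le_trans _ (row j)) // (bigD1 k) //= lerDl.
  exact: sumr_ge0.
- by move=> j k jk; rewrite mxE (stair_fit d_ge0 eff_ge0 chain) ?mul0r.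
by move=> k; apply: le_trans (col k) (eff_le_capa k).
Qed.

Lemma stair_mx_value :
  lp_value I (stair_mx d) = \sum_j profit I j / c j * d j.
Proof.
by apply: eq_bigr => j _; rewrite stair_mx_row mulrA mulrAC.
Qed.

End StairSolution.

Lemma load_ge_cost (f : assignment m p) j k :
  f j = Some k -> c j <= load I f k.
Proof.
move=> fjk; rewrite /load (bigD1 j) ?fjk //= lerDl.
by apply: sumr_ge0 => i _; apply/ltW/(cost_gt0 vI).
Qed.

Lemma sum_assigned (f : assignment m p) (P : pred 'I_m) (F : 'I_m -> R) :
  \sum_(j | P j && (f j != None)) F j
    = \sum_k \sum_(j | P j && (f j == Some k)) F j.
Proof.
rewrite (exchange_big_dep (fun j => P j && (f j != None))) /=.
  apply: eq_bigr => j /andP[-> nfj] /=; case: (f j) nfj => // k _.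
  by rewrite (big_pred1 k) // => t; rewrite eq_sym.
by move=> k j _ /andP[-> /eqP ->].
Qed.

(** Inside a cluster the items of cost at least [b] obey two bounds, the cluster capacity and the
    total capacity of the knapsacks able to hold them; the shares dominate the smaller bound. *)
Lemma assignment_chain (f : assignment m p) b : feasible I f ->
  \sum_(j | (b <= c j) && (f j != None)) c j <= room B eff b.
Proof.
case/andP=> /forallP fB /forallP fU; rewrite sum_assigned.
rewrite (partition_big (clus I) predT) //= /room.
rewrite [leRHS](partition_big (clus I) predT) //=; apply: ler_sum => l _.
under [leRHS]eq_bigl do rewrite andbC.
apply: le_trans (sum_eff_large l b).
have le_load k : \sum_(j | (b <= c j) && (f j == Some k)) c j <= load I f k.
  rewrite /load big_mkcond [leRHS]big_mkcond; apply: ler_sum => j _.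
  case: (b <= c j) => //=; case: ifP => // _; exact/ltW/(cost_gt0 vI).
rewrite le_min; apply/andP; split.
  by apply: le_trans (fU l); apply: ler_sum.
rewrite big_mkcond [leRHS]big_mkcond; apply: ler_sum => k _.
case: eqP => //= _; case: (leP b (B k)) => bk; first exact: le_trans (le_load k) (fB k).
rewrite big_pred0 // => j; apply/negP => /andP[bj /eqP fj].
have := load_ge_cost fj; have := fB k; lra.
Qed.

(** An optimal assignment may violate the shares, so it need not solve the linear program itself.
    Only the costs of its assigned items are kept, and the staircase distributes them anew. *)
Lemma OPT_le_lp xopt : lp_optimal I pi xopt -> OPT I <= lp_value I xopt.
Proof.
case=> fx opt.
have lp0 x : lp_feasible I pi x -> 0 <= lp_value I x.
  move=> fx'; apply: sumr_ge0 => j _; apply: mulr_ge0.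
    exact/ltW/(profit_gt0 vI).
  by apply: sumr_ge0 => k _; case/andP: (lp_box fx' j k).
rewrite /OPT; elim/big_ind: _ => [|a b la lb|f ff].
- exact: lp0.
- by rewrite ge_max la.
pose d j := if f j != None then c j else 0.
have db j : 0 <= d j <= c j.
  by rewrite /d; have := cost_gt0 vI j; case: ifP => _; lra.
have dc i : \sum_(t | c i <= c t) d t <= room B eff (c i).
  by rewrite /d -big_mkcondr; apply: assignment_chain.
apply: le_trans (opt _ (stair_mx_feasible db dc)).
rewrite stair_mx_value // /value big_mkcond; apply: ler_sum => j _.
rewrite /d; case: ifP => _; last by rewrite mulr0.
by rewrite divfK // lt0r_neq0 ?(cost_gt0 vI).
Qed.

End EffectiveCapacity.

(** * Rounding *)

Section Rounding.

Variables (R : realFieldType) (m p q : nat) (I : mkpc R m p q).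
Variable pi : 'I_p -> nat.
Hypothesis vI : mkpc_valid I.
Hypothesis ixpi : indexing I pi.

Definition assign_of (b : 'I_m -> 'I_p -> bool) : assignment m p :=
  [ffun j => [pick k | b j k]].

Section AssignOf.

Variable b : 'I_m -> 'I_p -> bool.
Hypothesis b_fun : forall j k k', b j k -> b j k' -> k = k'.

Lemma assign_ofE j k : (assign_of b j == Some k) = b j k.
Proof.
rewrite ffunE; case: pickP => [k' bk'|no]; last by rewrite no.
by apply/eqP/idP => [[<-//]|bk]; congr Some; apply: b_fun bk' bk.
Qed.

Lemma mx_of_assign_of :
  mx_of_assignment R (assign_of b) = \matrix_(j, k) (b j k)%:R.
Proof. by apply/matrixP => j k; rewrite !mxE assign_ofE. Qed.

Lemma load_assign_of k : load I (assign_of b) k = \sum_(j | b j k) cost I j.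
Proof. by apply: eq_bigl => j; rewrite assign_ofE. Qed.

End AssignOf.

Lemma value_lp (f : assignment m p) :
  value I f = lp_value I (mx_of_assignment R f).
Proof.
rewrite /value /lp_value big_mkcond; apply: eq_bigr => j _.
under eq_bigr do rewrite mxE.
case fj: (f j) => [k|] /=.
  rewrite (bigD1 k) //= eqxx big1 ?addr0 ?mulr1 // => t.
  by rewrite -(inj_eq Some_inj) eq_sym => /negPf ->.
by rewrite big1 ?mulr0 // => t _; rewrite eq_sym.
Qed.

Variables (x : 'M[R]_(m, p)) (M : {set 'I_m * 'I_p}).
Hypothesis fx : lp_feasible I pi x.
Hypothesis satM : saturating_matching (support_graph x) M.

Let x_ge0 j k : 0 <= x j k. Proof. by case/andP: (lp_box fx j k). Qed.

Lemma lp_mass2 j k k' : k != k' -> x j k + x j k' <= 1.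
Proof.
move=> nkk'; apply: le_trans (lp_item fx j).
rewrite (bigD1 k) //= (bigD1 k') 1?eq_sym //= addrA lerDl.
exact: sumr_ge0.
Qed.

Definition whole j k := x j k == 1.
Definition split_in (P : pred 'I_p) j k :=
  [&& 0 < x j k < 1, P k & (j, k) \in M].

Lemma whole_fun j k k' : whole j k -> whole j k' -> k = k'.
Proof.
move=> /eqP w /eqP w'; apply/eqP; apply: contraT => /(@lp_mass2 j).
by rewrite w w'; lra.
Qed.

Lemma matching_item j k k' : (j, k) \in M -> (j, k') \in M -> k = k'.
Proof.
by case: satM => -[_ inj] _ e e'; case: (inj _ _ e e' (or_introl erefl)).
Qed.

Lemma matching_knapsack j j' k : (j, k) \in M -> (j', k) \in M -> j = j'.
Proof.
by case: satM => -[_ inj] _ e e'; case: (inj _ _ e e' (or_intror erefl)).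
Qed.

Lemma split_in_fun P j k k' : split_in P j k -> split_in P j k' -> k = k'.
Proof. by case/and3P=> _ _ e /and3P[_ _]; apply: matching_item. Qed.

Lemma lp_cluster l :
  \sum_(k | clus I k == l) \sum_j cost I j * x j k <= ucap I l.
Proof.
apply: le_trans (sum_eff_le vI ixpi l); apply: ler_sum => k _.
exact: lp_zstar fx k.
Qed.

Lemma whole_feasible : feasible I (assign_of whole).
Proof.
have le k : load I (assign_of whole) k <= \sum_j cost I j * x j k.
  rewrite (load_assign_of whole_fun) big_mkcond; apply: ler_sum => j _.
  case: ifP => [/eqP ->|_]; rewrite ?mulr1 //; apply: mulr_ge0 => //.
  exact/ltW/(cost_gt0 vI).
apply/andP; split; apply/forallP.
  by move=> k; apply: le_trans (le k) (lp_capa fx k).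
by move=> l; apply: le_trans (lp_cluster l); apply: ler_sum.
Qed.

(** A knapsack receives at most its matched item, which fits alone because [lp_fit] excludes
    positive entries otherwise. The value 0 for untouched knapsacks is what later discards those
    beyond the critical one. *)
Lemma split_load P k : load I (assign_of (split_in P)) k <=
  if P k && [exists j, 0 < x j k] then capa I k else 0.
Proof.
rewrite (load_assign_of (@split_in_fun P)).
case: (pickP (fun j => split_in P j k)) => [j bj|no]; last first.
  by rewrite big_pred0 //; case: ifP => // _; apply/ltW/(capa_gt0 vI).
rewrite (big_pred1 j) => [|i]; last first.
  apply/idP/eqP => [bi|->//].
  case/and3P: bj => _ _ e; case/and3P: bi => _ _ e'.
  exact: matching_knapsack e' e.
have /and3P[/andP[xj _] -> _] := bj.
have -> /= : [exists j, 0 < x j k] by apply/existsP; exists j.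
by rewrite leNgt; apply/negP => /(lp_fit fx) x0; rewrite x0 ltxx in xj.
Qed.

Lemma split_load_capa P k : load I (assign_of (split_in P)) k <= capa I k.
Proof.
apply: le_trans (split_load P k) _; case: ifP => // _.
exact/ltW/(capa_gt0 vI).
Qed.

Lemma eff_gt0 j k : 0 < x j k -> 0 < eff I pi k.
Proof.
move=> xjk; apply: lt_le_trans (lp_zstar fx k).
rewrite (bigD1 j) //= ltr_pwDl ?mulr_gt0 ?(cost_gt0 vI) //.
by apply: sumr_ge0 => i _; apply: mulr_ge0 => //; apply/ltW/(cost_gt0 vI).
Qed.

(** A positive entry needs a positive share, so a noncritical knapsack in use precedes the critical
    one and its share is its whole capacity. Filling it completely therefore stays within the
    shares, whose sum the cluster admits. *)
Lemma noncritical_feasible :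
  feasible I (assign_of (split_in (fun k => ~~ critical I pi k))).
Proof.
apply/andP; split; apply/forallP; first exact: split_load_capa.
move=> l; apply: le_trans (sum_eff_le vI ixpi l); apply: ler_sum => k ckl.
apply: le_trans (split_load _ k) _.
case: ifP => [/andP[nc /existsP[j /eff_gt0]]|_]; last exact: eff_ge0.
have [t ct crt] := critical_exists vI ixpi (clus I k).
case: (ltngtP (pi k) (pi t)) => kt.
- by rewrite (eff_before_critical vI ixpi _ crt).
- by rewrite (eff_after_critical vI ixpi _ crt) // ltxx.
by case/negP: nc; rewrite (indexing_inj ixpi (esym ct) kt).
Qed.

Lemma critical_feasible :
  feasible I (assign_of (split_in (critical I pi))).
Proof.
apply/andP; split; apply/forallP; first exact: split_load_capa.
move=> l; have [t ct crt] := critical_exists vI ixpi l.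
rewrite (bigD1 t) ?ct //= big1 ?addr0.
  by apply: le_trans (split_load_capa _ t) _; rewrite -ct (capa_le_ucap vI).
move=> k /andP[/eqP ck nkt].
rewrite (load_assign_of (@split_in_fun _)) big_pred0 // => j.
apply/negP => /and3P[_ crk _]; case/eqP: nkt.
by apply: (critical_uniq vI ixpi crk crt); rewrite ck.
Qed.

Lemma cand1E : cand1 x = mx_of_assignment R (assign_of whole).
Proof. by rewrite (mx_of_assign_of whole_fun). Qed.

Lemma cand2E : cand2 I pi x M
  = mx_of_assignment R (assign_of (split_in (fun k => ~~ critical I pi k))).
Proof. by rewrite (mx_of_assign_of (@split_in_fun _)). Qed.

Lemma cand3E : cand3 I pi x M
  = mx_of_assignment R (assign_of (split_in (critical I pi))).
Proof. by rewrite (mx_of_assign_of (@split_in_fun _)). Qed.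

Lemma lp_value_cands : lp_value I x <=
  lp_value I (cand1 x) + lp_value I (cand2 I pi x M) + lp_value I (cand3 I pi x M).
Proof.
rewrite /lp_value -!big_split /=; apply: ler_sum => j _.
rewrite -!mulrDr; apply: ler_wpM2l; first exact/ltW/(profit_gt0 vI).
rewrite -!big_split /=.
under [leRHS]eq_bigr do rewrite !mxE.
(* A split row has total at most 1, already supplied by its matched edge; an unsplit row consists of
   zeros and ones and is reproduced by [cand1]. *)
case: (pickP (fun k => 0 < x j k < 1)) => [k xk|no].
  apply: (le_trans (lp_item fx j)).
  have [k' ek'] : exists k', (j, k') \in M.
    by case: satM => _ /(_ j k); apply; rewrite inE.
  have xk' : 0 < x j k' < 1.
    by case: satM => -[/subsetP sub _] _; have := sub _ ek'; rewrite inE.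
  rewrite (bigD1 k') //= xk' ek' andbT /=.
  have S0 : 0 <= \sum_(i | i != k') ((x j i == 1)%:R
      + [&& 0 < x j i < 1, ~~ critical I pi i & (j, i) \in M]%:R
      + [&& 0 < x j i < 1, critical I pi i & (j, i) \in M]%:R) :> R.
    by apply: sumr_ge0 => i _; rewrite !addr_ge0.
  by case: (critical I pi k') => /=; case: (x j k' == 1) => /=; lra.
apply: ler_sum => k _; have := no k; rewrite /= => xk.
have -> : x j k = (x j k == 1)%:R.
  case: eqP => // nx1; apply/eqP; rewrite eq_le x_ge0 andbT leNgt.
  apply/negP => x0; move: xk; rewrite x0 /= lt_neqAle => /negP; apply.
  by case/andP: (lp_box fx j k) => _ ->; rewrite andbT; apply/eqP.
by case: eqP => _; rewrite ?eqxx ?ltxx ?andbF /= ?addr0 // -addrA lerDl addr_ge0.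
Qed.

End Rounding.

Lemma algorithm2_approx (R : realFieldType) (m p q : nat) (I : mkpc R m p q)
    (pi : 'I_p -> nat) (xopt x : 'M[R]_(m, p))
    (M : {set 'I_m * 'I_p}) (y : 'M[R]_(m, p)) :
  mkpc_valid I -> algorithm2_run I pi xopt x M y ->
  exists f : assignment m p,
    [/\ y = mx_of_assignment R f, feasible I f & 1 / 3 * OPT I <= value I f].
Proof.
move=> vI [ixpi lpo fx _ vx satM yin best].
have opt := le_trans (OPT_le_lp vI ixpi lpo) vx.
have third : 1 / 3 * OPT I <= lp_value I y.
  have b1 := best (cand1 x); have b2 := best (cand2 I pi x M).
  have b3 := best (cand3 I pi x M).
  have := lp_value_cands vI fx satM; move: b1 b2 b3; rewrite !inE !eqxx ?orbT.
  by move=> /(_ isT) b1 /(_ isT) b2 /(_ isT) b3; lra.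
suff [f yf ff] : exists2 f, y = mx_of_assignment R f & feasible I f.
  by exists f; rewrite value_lp -yf.
move: yin; rewrite !inE => /or3P[] /eqP ->.
- exists (assign_of (whole x)); first exact: cand1E fx.
  exact: whole_feasible vI ixpi _ fx.
- eexists; first exact: (cand2E I pi satM).
  exact: noncritical_feasible vI ixpi _ _ fx satM.
eexists; first exact: (cand3E I pi satM).
exact: critical_feasible vI ixpi _ _ fx satM.
Qed.

(** * Bit lengths and loops *)

Section Bits.

Lemma nbits_gt z : (`|z| < 2 ^ nbits z)%N.
Proof. exact: trunc_log_ltn. Qed.

Lemma nbits_le z n : (0 < n)%N -> (`|z| < 2 ^ n)%N -> (nbits z <= n)%N.
Proof.
move=> n0 zn; rewrite /nbits; case: (posnP `|z|) => [->|z0].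
  by rewrite trunc_log0.
by rewrite -(ltn_exp2l _ _ (isT : 1 < 2)%N) (leq_ltn_trans _ zn) // trunc_logP.
Qed.

Lemma nbits_add u v : (nbits (u + v) <= nbits u + nbits v)%N.
Proof.
apply: nbits_le => //; have := nbits_gt u; have := nbits_gt v.
rewrite expnD; set a := (2 ^ _)%N; set b := (2 ^ _)%N => vb ua.
have b2 : (2 <= b)%N by rewrite /b -[X in (X <= _)%N]expn1 leq_exp2l.
have a2 : (2 <= a)%N by rewrite /a -[X in (X <= _)%N]expn1 leq_exp2l.
by nia.
Qed.

Lemma nbits_opp u : nbits (- u) = nbits u.
Proof. by rewrite /nbits abszN. Qed.

Lemma nbits_mul u v : (nbits (u * v) <= nbits u + nbits v)%N.
Proof.
apply: nbits_le => //; rewrite abszM expnD.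
by apply: ltn_mul; apply: nbits_gt.
Qed.

Lemma nbits_div u v : (nbits (u %/ v)%Z <= nbits u + nbits v)%N.
Proof.
apply: nbits_le => //; apply: (@leq_ltn_trans `|u|).
  exact: lez_div.
by apply: leq_trans (nbits_gt u) _; rewrite leq_exp2l // leq_addr.
Qed.

Lemma nbits_nat (n : nat) : (nbits n%:Z <= n.+1)%N.
Proof.
apply: nbits_le => //=; apply: ltnW; exact: (ltn_expl n.+1 (isT : 1 < 2)%N).
Qed.

End Bits.

(** * Bit lengths and running times of expressions *)

Section Expressions.

Definition bounded (W : nat) (s : store) : Prop :=
  forall a i, (nbits (s a i) <= W)%N.

(** Bit length of the value in units of the store bound [W]. Every operation at most adds bit
    lengths, so one clause covers all four; a read counts 1 whatever its address. *)
Fixpoint expr_size (e : expr) : nat :=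
  match e with
  | Const z => nbits z
  | Read _ _ => 1
  | Bin _ e1 e2 => expr_size e1 + expr_size e2
  end.

Fixpoint expr_cost (e : expr) : nat :=
  match e with
  | Const z => nbits z
  | Read _ e1 => expr_cost e1 + expr_size e1 + 1
  | Bin _ e1 e2 => expr_cost e1 + expr_cost e2 + expr_size e1 + expr_size e2
  end.

Lemma bounded_gt0 W s : bounded W s -> (0 < W)%N.
Proof. by move/(_ 0%N 0%N); apply: leq_ltn_trans. Qed.

Lemma bounded_le W W' s : (W <= W')%N -> bounded W s -> bounded W' s.
Proof. by move=> le bs a i; apply: leq_trans (bs a i) le. Qed.

Lemma bounded_update W s a i v :
  bounded W s -> (nbits v <= W)%N -> bounded W (update s a i v).
Proof. by move=> bs bv b k; rewrite /update; case: ifP. Qed.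

Lemma nbits_expr W s e :
  bounded W s -> (nbits (expr_val s e) <= expr_size e * W)%N.
Proof.
move=> bs; have W0 := bounded_gt0 bs.
elim: e => [z|a e IH|o e1 IH1 e2 IH2] /=; first by rewrite leq_pmulr.
  by rewrite mul1n.
rewrite mulnDl; apply: leq_trans (leq_add IH1 IH2).
case: o => /=; [exact: nbits_add| |exact: nbits_mul|exact: nbits_div].
by rewrite -[nbits (expr_val s e2)]nbits_opp nbits_add.
Qed.

Lemma expr_time_le W s e :
  bounded W s -> (expr_time s e <= expr_cost e * W)%N.
Proof.
move=> bs; have W0 := bounded_gt0 bs.
elim: e => [z|a e IH|o e1 IH1 e2 IH2] /=; first by rewrite leq_pmulr.
  have := nbits_expr e bs; have := bs a `|expr_val s e|%N.
  by rewrite !mulnDl mul1n; lia.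
have := nbits_expr e1 bs; have := nbits_expr e2 bs.
by rewrite !mulnDl; lia.
Qed.

Definition write_cost (e1 e2 : expr) : nat :=
  expr_cost e1 + expr_cost e2 + expr_size e1 + expr_size e2.

Lemma exec_write W s a e1 e2 : bounded W s ->
  exists2 t, exec (Write a e1 e2) s t
               (update s a `|expr_val s e1|%N (expr_val s e2)) &
             (t <= write_cost e1 e2 * W)%N.
Proof.
move=> bs; eexists; first exact: ExecWrite.
have := nbits_expr e1 bs; have := nbits_expr e2 bs.
have := expr_time_le e1 bs; have := expr_time_le e2 bs.
by rewrite /write_cost !mulnDl; lia.
Qed.

Fixpoint reads (e : expr) : seq nat :=
  match e with
  | Const _ => [::]
  | Read a e1 => a :: reads e1
  | Bin _ e1 e2 => reads e1 ++ reads e2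
  end.

Lemma eq_expr_val s s' e : {in reads e, forall a, s a =1 s' a} ->
  expr_val s e = expr_val s' e.
Proof.
elim: e => [z|a e IH|o e1 IH1 e2 IH2] //= E.
  by rewrite IH => [|b be]; apply: E; rewrite inE ?eqxx ?be ?orbT.
by rewrite IH1 ?IH2 // => a ae; apply: E; rewrite mem_cat ae ?orbT.
Qed.

End Expressions.

(** * Counting loops *)

Section ForLoop.

Definition cell (v : nat) : expr := Read v (Const 0).
Definition set_cell (v : nat) (e : expr) : cmd := Write v (Const 0) e.

Definition for_cmd (v : nat) (N : expr) (body : cmd) : cmd :=
  Seq (set_cell v (Const 0))
      (While (Bin Defs.Sub N (cell v))
         (Seq body (set_cell v (Bin Add (cell v) (Const 1))))).

(** The bound [N] is evaluated again at every test, so the invariant has to preserve its value [n]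
    along with the counter. *)
Lemma exec_for (v : nat) (N : expr) (body : cmd) (n T W : nat)
    (Inv : nat -> store -> Prop) (s : store) :
  (forall i s, Inv i s ->
     [/\ bounded W s, s v 0%N = i%:Z & expr_val s N = n%:Z]) ->
  (forall i s, (i < n)%N -> Inv i s -> exists t s',
     [/\ exec body s t s', (t <= T)%N, bounded W s', s' v 0%N = i%:Z &
         Inv i.+1 (update s' v 0 i.+1%:Z)]) ->
  bounded W s -> Inv 0%N (update s v 0 0) ->
  exists t s', [/\ exec (for_cmd v N body) s t s',
    (t <= n * (T + (expr_cost (Bin Defs.Sub N (cell v)) +
                    write_cost (Const 0) (Bin Add (cell v) (Const 1))) * W)
          + (write_cost (Const 0) (Const 0)
             + expr_cost (Bin Defs.Sub N (cell v))) * W)%N & Inv n s'].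
Proof.
move=> InvP step bs Inv0.
have [t0 ex0 le0] := exec_write v (Const 0) (Const 0) bs.
set test := Bin Defs.Sub N (cell v); set K := (_ + write_cost _ _)%N.
suff H : forall k i s, (i + k = n)%N -> Inv i s -> exists t s',
  [/\ exec (While test (Seq body (set_cell v (Bin Add (cell v) (Const 1)))))
        s t s',
      (t <= k * (T + K * W) + expr_cost test * W)%N & Inv n s'].
  have [t [s' [ex le Inv']]] := H n 0%N _ (add0n n) Inv0.
  exists (t0 + t)%N, s'; split => //; first exact: ExecSeq ex0 ex.
  by rewrite mulnDl; lia.
clear t0 ex0 le0 s bs Inv0.
elim=> [|k IH] i s eik Ii.
  have [bs si sN] := InvP i s Ii.
  exists (expr_time s test), s; split.
  - apply: ExecWhileFalse; rewrite /= sN si; lia.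
  - by rewrite mul0n add0n; apply: expr_time_le.
  - by move: Ii; rewrite -eik addn0.
have [bs si sN] := InvP i s Ii.
have lt_in : (i < n)%N by lia.
have [t1 [s1 [ex1 le1 bs1 si1 Ii1]]] := step i s lt_in Ii.
have [t2] := exec_write v (Const 0) (Bin Add (cell v) (Const 1)) bs1.
rewrite /= si1 => ex2 le2.
have e1 : i%:Z + 1 = i.+1%:Z by lia.
rewrite e1 in ex2.
have eik1 : (i.+1 + k = n)%N by lia.
have [t3 [s3 [ex3 le3 Inv3]]] := IH i.+1 _ eik1 Ii1.
exists (expr_time s test + (t1 + t2) + t3)%N, s3; split => //.
  apply: ExecWhileTrue ex3; first by rewrite /= sN si; lia.
  exact: ExecSeq ex1 ex2.
have EK : (K * W = expr_cost test * W
    + write_cost (Const 0) (Bin Add (cell v) (Const 1)) * W)%N.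
  by rewrite /K mulnDl.
change (expr_time s test + (t1 + t2) + t3
  <= k.+1 * (T + K * W) + expr_cost test * W)%N.
clearbody K test. have Et := expr_time_le test bs; rewrite (mulSn k) EK.
apply: leq_trans (leq_add (leq_add Et (leq_add le1 le2)) le3) _.
by rewrite EK; lia.
Qed.

End ForLoop.

(** * Programs made of folds *)

Section Macros.

(* For a negative [u], the quotient of [u] by [u * u + 1] rounds down to -1. *)
Definition Eneg (e : expr) : expr :=
  Bin Defs.Sub (Const 0) (Bin Div e (Bin Add (Bin Mul e e) (Const 1))).
(** Truth values are the integers 0 and 1, so a product is a conjunction and choices need no
    branching: every loop body remains a plain expression. *)
Definition Elt (e1 e2 : expr) : expr := Eneg (Bin Defs.Sub e1 e2).
Definition Enot (e : expr) : expr := Bin Defs.Sub (Const 1) e.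
Definition Ele (e1 e2 : expr) : expr := Enot (Elt e2 e1).
Definition Eeq (e1 e2 : expr) : expr := Bin Mul (Ele e1 e2) (Ele e2 e1).
Definition Emin (e1 e2 : expr) : expr :=
  Bin Add e2 (Bin Mul (Elt e1 e2) (Bin Defs.Sub e1 e2)).

Variable s : store.

Lemma Eneg_val e : expr_val s (Eneg e) = ((expr_val s e < 0)%R : bool)%:Z.
Proof.
rewrite /=; set u := expr_val s e; set D := u * u + 1.
have D0 : 0 < D by rewrite /D; nia.
have small r : 0 <= r -> r < D -> (r %/ D)%Z = 0.
  by move=> r0 rD; rewrite divz_small // r0 gtz0_abs.
case: ltP => u0; first by rewrite -[u in (u %/ _)%Z](_ : (-1) * D + (u + D) = u)
  ?divzMDl ?small //; rewrite /D; nia.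
by rewrite small ?subr0 // /D; nia.
Qed.

Lemma Elt_val e1 e2 :
  expr_val s (Elt e1 e2) = ((expr_val s e1 < expr_val s e2)%R : bool)%:Z.
Proof. by rewrite Eneg_val /= subr_lt0. Qed.

Lemma Enot_val e (b : bool) :
  expr_val s e = b%:Z -> expr_val s (Enot e) = (~~ b)%:Z.
Proof. by move=> /= ->; case: b. Qed.

Lemma Ele_val e1 e2 :
  expr_val s (Ele e1 e2) = ((expr_val s e1 <= expr_val s e2)%R : bool)%:Z.
Proof. by rewrite (Enot_val (Elt_val _ _)) -leNgt. Qed.

Lemma Eeq_val e1 e2 :
  expr_val s (Eeq e1 e2) = (expr_val s e1 == expr_val s e2 : bool)%:Z.
Proof.
change (expr_val s (Ele e1 e2) * expr_val s (Ele e2 e1) =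
  (expr_val s e1 == expr_val s e2 : bool)%:Z).
rewrite !Ele_val eq_le.
by case: (expr_val s e1 <= _)%R; case: (expr_val s e2 <= _)%R.
Qed.

Lemma Emin_val e1 e2 : expr_val s (Emin e1 e2)
  = Num.min (expr_val s e1) (expr_val s e2).
Proof.
change (expr_val s e2 + expr_val s (Elt e1 e2) *
  (expr_val s e1 - expr_val s e2) = Num.min (expr_val s e1) (expr_val s e2)).
rewrite Elt_val.
by case: ltP => _; rewrite ?mul1r ?mul0r ?addr0 // addrC subrK.
Qed.

End Macros.

Inductive fold_op := FoldAdd | FoldMul | FoldMin.

Definition fold_expr (o : fold_op) : expr -> expr -> expr :=
  match o with FoldAdd => Bin Add | FoldMul => Bin Mul | FoldMin => Emin end.

Definition fold_val (o : fold_op) : int -> int -> int :=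
  match o with FoldAdd => +%R | FoldMul => *%R | FoldMin => Num.min end.

Lemma fold_exprE o e1 e2 s : expr_val s (fold_expr o e1 e2)
  = fold_val o (expr_val s e1) (expr_val s e2).
Proof. by case: o => //=; exact: Emin_val. Qed.

Lemma nbits_fold o u v : (nbits (fold_val o u v) <= nbits u + nbits v)%N.
Proof.
case: o; [exact: nbits_add|exact: nbits_mul|].
by rewrite /= minEle; case: ifP => _; rewrite ?leq_addr ?leq_addl.
Qed.

(* Cell [i] of array [target] receives the fold of [body] over [t], starting
   from [init]; [i] and [t] range over products of cells of array 0.  Arrays
   20 and 21 hold [i] and [t], array 22 the accumulator. *)
Record phase := Phase {
  target : nat;
  oper : fold_op;
  outer : seq nat;
  inner : seq nat;
  init : expr;
  body : expr
}.

Definition loop_expr (ds : seq nat) : expr :=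
  foldr (fun d e => Bin Mul (Read 0 (Const d%:Z)) e) (Const 1) ds.

Definition loop_size (extent : nat -> nat) (ds : seq nat) : nat :=
  foldr (fun d n => extent d * n)%N 1%N ds.

Definition phase_cmd (ph : phase) : cmd :=
  for_cmd 20 (loop_expr (outer ph))
    (Seq (set_cell 21 (Const 0))
    (Seq (set_cell 22 (init ph))
    (Seq (for_cmd 21 (loop_expr (inner ph))
            (set_cell 22 (fold_expr (oper ph) (cell 22) (body ph))))
         (Write (target ph) (cell 20) (cell 22))))).

Definition env (s : store) (i t : int) : store :=
  update (update s 20 0 i) 21 0 t.

Definition phase_val (ph : phase) (s : store) (i n : nat) : int :=
  iteri n
    (fun t acc => fold_val (oper ph) acc (expr_val (env s i%:Z t%:Z) (body ph)))
    (expr_val (env s i%:Z 0) (init ph)).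

Definition phase_ok (ph : phase) : bool :=
  [&& target ph \notin [:: 0; 20; 21; 22]%N,
      target ph \notin reads (init ph) ++ reads (body ph) &
      22 \notin reads (init ph) ++ reads (body ph)].

Section PhaseExec.

Variables (ph : phase) (extent : nat -> nat).
Hypothesis ok : phase_ok ph.

Let N1 := loop_size extent (outer ph).
Let N2 := loop_size extent (inner ph).

Lemma loop_exprE s ds : (forall d, s 0%N d = (extent d)%:Z) ->
  expr_val s (loop_expr ds) = (loop_size extent ds)%:Z.
Proof. by move=> E; elim: ds => //= d ds ->; rewrite E PoszM. Qed.

Definition fixed_cell (a k : nat) : bool :=
  (a \notin [:: target ph; 22%N]) && ((a \in [:: 20; 21]%N) ==> (k != 0%N)).

Definition phase_post (s s' : store) : Prop :=
  (forall a k, fixed_cell a k -> s' a k = s a k) /\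
  (forall i, (i < N1)%N -> s' (target ph) i = phase_val ph s i N2).

(** A fold step adds at most the bits of one body value, even for products, so growth is linear in
    the number of steps. The counters enter through [n1 + n2 + 1], their bit length being bounded
    crudely by their value. *)
Definition phase_bits (W n1 n2 : nat) : nat :=
  ((1 + expr_size (init ph) + n2 * expr_size (body ph)) * (W + n1 + n2 + 1))%N.

Lemma bounded_env W s (i t : nat) : bounded W s -> (i <= N1)%N -> (t <= N2)%N ->
  bounded (W + N1 + N2 + 1) (env s i%:Z t%:Z).
Proof.
move=> bs iN tN; have ni := nbits_nat i; have nt := nbits_nat t.
do 2! (apply: bounded_update; last lia).
by apply: bounded_le bs; lia.
Qed.

Lemma nbits_phase_val W s (i t : nat) : bounded W s -> (i <= N1)%N -> (t <= N2)%N ->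
  (nbits (phase_val ph s i t) <= phase_bits W N1 N2)%N.
Proof.
move=> bs iN tN; apply: (@leq_trans ((expr_size (init ph) +
   t * expr_size (body ph)) * (W + N1 + N2 + 1))); last first.
  by apply: leq_mul => //; apply: leq_add; rewrite ?leq_addl ?leq_mul.
elim: t tN => [|t IH] tN.
  by rewrite addn0; apply/nbits_expr/bounded_env.
rewrite /phase_val iteriS -/(phase_val ph s i t).
apply: leq_trans (nbits_fold _ _ _) _.
have := IH (ltnW tN).
have := nbits_expr (body ph) (bounded_env bs iN (ltnW tN)).
move=> l1 l2; apply: leq_trans (leq_add l2 l1) _.
by rewrite -mulnDl leq_mul // mulSn; lia.
Qed.

Definition phase_cost (W n1 n2 : nat) : nat :=
  let K e v := (expr_cost (Bin Defs.Sub e (cell v)) +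
    write_cost (Const 0) (Bin Add (cell v) (Const 1)) +
    write_cost (Const 0) (Const 0))%N in
  let acc := fold_expr (oper ph) (cell 22) (body ph) in
  ((n1 + 1) * (n2 + 1) *
   (K (loop_expr (outer ph)) 20 + K (loop_expr (inner ph)) 21 +
    write_cost (Const 0) (Const 0) + write_cost (Const 0) (init ph) +
    write_cost (Const 0) acc + write_cost (cell 20) (cell 22)) *
   phase_bits W n1 n2)%N.

Let inner_cost n a b c d e f g V :
  (a * V + (b * V + (n * (c * V + (d + e) * V) + (f + d) * V + g * V)) <=
   ((n + 1) * (d + e + f + c) + a + b + g) * V)%N.
Proof.
have -> : (n * (c * V + (d + e) * V) = (n * (c + d + e)) * V)%N.
  by rewrite -mulnDl mulnA addnA.
rewrite -!mulnDl leq_mul2r; apply/orP; right.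
by rewrite !mulnDl !mulnDr; lia.
Qed.

Let outer_cost n1 n2 a b c d e f g h i V :
  (n1 * (((n2 + 1) * (a + b + c + d) + c + e + f) * V + (g + h) * V)
   + (i + g) * V <=
   (n1 + 1) * (n2 + 1) * ((g + h + i) + (a + b + c) + c + e + d + f) * V)%N.
Proof.
set X := (_ + e + f)%N.
have -> : (n1 * (X * V + (g + h) * V) = (n1 * (X + (g + h))) * V)%N.
  by rewrite -mulnDl mulnA.
rewrite -!mulnDl leq_mul2r; apply/orP; right; rewrite -mulnA.
set Y := ((n2 + 1) * _)%N.
have le : (X + (g + h) + i <= Y)%N by rewrite /X /Y !mulnDl !mulnDr; lia.
have : (n1 * (X + (g + h)) <= n1 * Y)%N.
  by rewrite leq_mul2l; apply/orP; right; lia.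
by rewrite (mulnDl n1 1 Y) mul1n; lia.
Qed.

Lemma exec_phase W s : bounded W s -> (forall d, s 0%N d = (extent d)%:Z) ->
  exists t s', [/\ exec (phase_cmd ph) s t s',
    (t <= phase_cost W N1 N2)%N, bounded (phase_bits W N1 N2) s' &
    phase_post s s'].
Proof.
move=> bs s0.
have [/and3P[]] := (ok, tt).
rewrite !inE !negb_or => /and4P[tg0 tg20 tg21 tg22].
rewrite !mem_cat !negb_or => /andP[tgi tgb] /andP[i22 b22].
set V := phase_bits W N1 N2.
have V1 : (N1 < V)%N by rewrite /V /phase_bits !mulnDl; lia.
have V2 : (N2 < V)%N by rewrite /V /phase_bits !mulnDl; lia.
have bVs : bounded V s by apply: bounded_le bs; rewrite /V /phase_bits !mulnDl; lia.
have nb0 : (nbits 0 <= V)%N by apply: nbits_le => //; lia.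
(* Outside the target and the accumulator, the store differs from the initial one only in the two
   counters; hence [init] and [body] keep the values they have in [env]. *)
pose agree (i t : int) (s' : store) :=
  forall a k, a \notin [:: target ph; 22%N] -> s' a k = env s i t a k.
have agree_loop i t s' : agree i t s' -> forall d, s' 0%N d = (extent d)%:Z.
  by move=> ag d; rewrite ag; [exact: s0|rewrite !inE negb_or eq_sym tg0].
have agree20 i t s' : agree i t s' -> s' 20%N 0%N = i.
  by move=> ag; rewrite ag; [|rewrite !inE negb_or eq_sym tg20].
have agree21 i t s' : agree i t s' -> s' 21%N 0%N = t.
  by move=> ag; rewrite ag; [|rewrite !inE negb_or eq_sym tg21].
have agree_expr i t s' e : agree i t s' -> target ph \notin reads e ->
    22%N \notin reads e -> expr_val s' e = expr_val (env s i t) e.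
  move=> ag te e22; apply: eq_expr_val => a ae k; apply: ag.
  rewrite !inE negb_or; apply/andP; split; apply/eqP => ea.
    by rewrite -ea ae in te.
  by rewrite -ea ae in e22.
have agree_upd i t s' a k v : agree i t s' -> a \in [:: target ph; 22%N] ->
    agree i t (update s' a k v).
  move=> ag ain b l bn; rewrite /update; case: eqP => [eb|_]; last exact: ag.
  by rewrite eb ain in bn.
have agree_upd21 i t t' s' : agree i t s' -> agree i t' (update s' 21 0 t').
  move=> ag a k an; rewrite /env /update; case: ifP => // H.
  by rewrite ag // /env /update H.
(* The inner counter is existential here: between outer iterations it holds whatever the previous
   inner loop left, and it is reset before use. *)
pose OI (i : nat) (s' : store) :=
  [/\ bounded V s', exists t, agree i%:Z t s' &
      forall i', (i' < i)%N -> s' (target ph) i' = phase_val ph s i' N2].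
pose II (i : nat) (s1 : store) (t : nat) (s' : store) :=
  [/\ bounded V s', agree i%:Z t%:Z s', s' 22%N 0%N = phase_val ph s i t &
      s' (target ph) =1 s1 (target ph)].
rewrite /phase_cmd.
set inner_cmd := for_cmd 21 _ _; set outer_body := Seq _ _.
have [||||t [s' [ex le [bs' [t' ag] val]]]] :=
    @exec_for 20 (loop_expr (outer ph)) outer_body N1
     (((N2 + 1) * (
       expr_cost (Bin Defs.Sub (loop_expr (inner ph)) (cell 21)) +
       write_cost (Const 0) (Bin Add (cell 21) (Const 1)) +
       write_cost (Const 0) (Const 0)
       + write_cost (Const 0) (fold_expr (oper ph) (cell 22) (body ph)))
      + write_cost (Const 0) (Const 0) + write_cost (Const 0) (init ph)
      + write_cost (cell 20) (cell 22)) * V)%N V OI s.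
- move=> i s' [bs' [t ag] _]; split => //; first exact: agree20 ag.
  by apply: loop_exprE; apply: agree_loop ag.
- move=> i s1 iN [bs1 [t1 ag1] val1].
  have [w1 ex1 le1] := exec_write 21 (Const 0) (Const 0) bs1.
  have ag2 := agree_upd21 _ _ 0 _ ag1.
  have bs2 : bounded V (update s1 21 0 0) by apply: bounded_update.
  set s2 := update s1 21 0 0 in ag2 bs2.
  have [w2 ex2 le2] := exec_write 22 (Const 0) (init ph) bs2.
  have ei : expr_val s2 (init ph) = phase_val ph s i 0.
    by rewrite (agree_expr _ _ _ _ ag2).
  rewrite ei in ex2; set s3 := update s2 _ _ _ in ex2.
  have bs3 : bounded V s3.
    by apply: bounded_update => //; apply: nbits_phase_val => //; apply: ltnW.
  have ag3 : agree i%:Z 0 s3 by apply: agree_upd => //; rewrite !inE eqxx orbT.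
  have [||||w4 [s4 [ex4 le4 [bs4 ag4 acc4 val4]]]] :=
     @exec_for 21 (loop_expr (inner ph))
      (set_cell 22 (fold_expr (oper ph) (cell 22) (body ph))) N2
      (write_cost (Const 0) (fold_expr (oper ph) (cell 22) (body ph)) * V)%N
      V (II i s3) s3.
  + move=> t s' [bs' ag _ _]; split => //; first exact: agree21 ag.
    by apply: loop_exprE; apply: agree_loop ag.
  + move=> t s' tN [bs' ag acc val].
    have [w exw lew] := exec_write 22 (Const 0)
       (fold_expr (oper ph) (cell 22) (body ph)) bs'.
    have ev : expr_val s' (fold_expr (oper ph) (cell 22) (body ph))
        = phase_val ph s i t.+1.
      rewrite fold_exprE (agree_expr _ _ _ (body ph) ag) //.
      by rewrite -[expr_val s' (cell 22)]/(s' 22%N 0%N) acc.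
    rewrite ev in exw.
    have bv : (nbits (phase_val ph s i t.+1) <= V)%N.
      by apply: nbits_phase_val => //; apply: ltnW.
    exists w; eexists; split; [exact: exw|exact: lew| | |].
    * exact: bounded_update.
    * by rewrite /update /=; apply: agree21 ag.
    split.
    * apply: bounded_update; first exact: bounded_update.
      by apply: leq_trans (nbits_nat _) _; apply: leq_ltn_trans V2.
    * by apply: agree_upd21; apply: agree_upd ag _; rewrite !inE eqxx orbT.
    * by [].
    * by move=> k; rewrite /update (negPf tg21) (negPf tg22) /= val.
  + by [].
  + split; [exact: bounded_update| exact: agree_upd21 ag3| by [] |].
    by move=> k; rewrite /update (negPf tg21).
  have [w5 ex5 le5] := exec_write (target ph) (cell 20) (cell 22) bs4.
  have e20 : s4 20%N 0%N = i%:Z by apply: agree20 ag4.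
  rewrite /= e20 acc4 /= in ex5.
  have bv : (nbits (phase_val ph s i N2) <= V)%N.
    by apply: nbits_phase_val => //; apply: ltnW.
  exists (w1 + (w2 + (w4 + w5)))%N; eexists; split.
  + apply: ExecSeq ex1 _; apply: ExecSeq ex2 _; exact: ExecSeq ex4 ex5.
  + apply: leq_trans (leq_add le1 (leq_add le2 (leq_add le4 le5))) _.
    exact: inner_cost.
  + exact: bounded_update.
  + by rewrite /update eq_sym (negPf tg20) /= e20.
  split.
  + apply: bounded_update; first exact: bounded_update.
    by apply: leq_trans (nbits_nat _) _; apply: leq_ltn_trans V1.
  + exists N2%:Z; move=> a k an; rewrite /update; move: (an).
    rewrite !inE negb_or => /andP[/negPf -> /= _].
    case: (boolP ((a == 20%N) && (k == 0%N))) => [/andP[/eqP -> /eqP ->]|H].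
      by rewrite /env /update.
    rewrite ag4 // /env /update; case: ifP => // _.
    by rewrite (negPf H).
  move=> i' ii'; rewrite /update (negPf tg20) /= eqxx /=.
  case: eqP => [->//|/eqP nii'].
  by rewrite val4 /s3 /s2 /update (negPf tg22) (negPf tg21) /= val1 // ltn_neqAle nii' -ltnS.
- by [].
- split; [exact: bounded_update | | by []].
  exists (s 21%N 0%N) => a k an; rewrite /env /update.
  by case: (boolP ((a == 21%N) && (k == 0%N))) => [/andP[/eqP -> /eqP ->]|_].
exists t, s'; split => //.
- apply: leq_trans le _; exact: outer_cost.
split=> [a k /andP[an ak]|i iN]; last exact: val.
rewrite ag // /env /update; move: ak.
by case: ifP => [/andP[/eqP -> /eqP ->]//|_]; case: ifP => [/andP[/eqP -> /eqP ->]//|].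
Qed.

End PhaseExec.

(** * Closure properties of polynomial bounds *)

Section Polynomials.
Local Open Scope nat_scope.

(** For positive [W] powers increase with the exponent, so a single monomial absorbs sums and
    constants. *)
Definition poly_bounded (f : nat -> nat) : Prop :=
  exists C d, forall W, 0 < W -> f W <= C * W ^ d.

Lemma poly_bounded_const c : poly_bounded (fun=> c).
Proof. by exists c, 0 => W _; rewrite muln1. Qed.

Lemma poly_bounded_id : poly_bounded id.
Proof. by exists 1, 1 => W _; rewrite mul1n expn1. Qed.

Lemma poly_bounded_mul f g :
  poly_bounded f -> poly_bounded g -> poly_bounded (fun W => f W * g W).
Proof.
move=> [C [d fC]] [C' [d' gC]]; exists (C * C'), (d + d') => W W0.
by rewrite expnD mulnACA leq_mul ?fC ?gC.
Qed.

Lemma poly_bounded_add f g :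
  poly_bounded f -> poly_bounded g -> poly_bounded (fun W => f W + g W).
Proof.
move=> [C [d fC]] [C' [d' gC]]; exists (C + C'), (d + d') => W W0.
rewrite mulnDl; apply: leq_add.
  by apply: leq_trans (fC W W0) _; rewrite leq_mul2l leq_pexp2l ?leq_addr ?orbT.
by apply: leq_trans (gC W W0) _; rewrite leq_mul2l leq_pexp2l ?leq_addl ?orbT.
Qed.

Lemma poly_bounded_exp k : poly_bounded (fun W => W ^ k).
Proof. by exists 1, k => W _; rewrite mul1n. Qed.

Lemma poly_bounded_comp f g : poly_bounded f -> poly_bounded g ->
  (forall W, 0 < W -> 0 < g W) -> poly_bounded (fun W => f (g W)).
Proof.
move=> [C [d fC]] [C' [d' gC]] g0; exists (C * C' ^ d), (d' * d) => W W0.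
apply: leq_trans (fC _ (g0 W W0)) _.
rewrite -mulnA leq_mul // expnM -expnMn.
by case: d {fC} => [//|d]; rewrite leq_exp2r // gC.
Qed.

End Polynomials.

(** * Sequences of phases *)

Definition prog_cmd (ps : seq phase) : cmd :=
  foldr (fun ph c => Seq (phase_cmd ph) c) Skip ps.

(* Every array is written by at most one phase and is read only after it, so
   that the final store satisfies the equations of all phases at once. *)
Fixpoint single_assignment (D : seq nat) (ps : seq phase) : bool :=
  if ps is ph :: ps' then
    [&& target ph \notin [:: 20; 21; 22]%N, target ph \notin D,
        all (fun a => a \in 20%N :: 21%N :: D)
          (reads (init ph) ++ reads (body ph)) &
        single_assignment (target ph :: D) ps']
  else true.

Definition solves (extent : nat -> nat) (s : store) (ph : phase) : Prop :=
  forall i, (i < loop_size extent (outer ph))%N ->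
    s (target ph) i = phase_val ph s i (loop_size extent (inner ph)).

(** Loops overwrite only cell 0 of the counter arrays, exactly the cell that [env] overrides. Their
    other cells must survive because [reads] records arrays but not addresses. *)
Definition kept (D : seq nat) (a k : nat) : bool :=
  (a \in D) || (a \in [:: 20; 21]%N) && (k != 0%N).

Lemma eq_phase_val ph s s' D i n :
  all (fun a => a \in 20%N :: 21%N :: D) (reads (init ph) ++ reads (body ph)) ->
  (forall a k, kept D a k -> s' a k = s a k) ->
  phase_val ph s' i n = phase_val ph s i n.
Proof.
move=> /allP rd E.
have envE (t : int) e : {subset reads e <= reads (init ph) ++ reads (body ph)} ->
    expr_val (env s' i%:Z t) e = expr_val (env s i%:Z t) e.
  move=> sub; apply: eq_expr_val => a /sub /rd aD k; rewrite /env /update.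
  case: ifP => // n21; case: ifP => // n20; apply: E; rewrite /kept.
  move: aD; rewrite !inE => /or3P[/eqP ea|/eqP ea|-> //].
    by move: n20; rewrite ea eqxx /= => ->; rewrite orbT.
  by move: n21; rewrite ea eqxx /= => ->; rewrite orbT.
elim: n => [|n IH]; first by apply: envE => a ai; rewrite mem_cat ai.
rewrite /phase_val !iteriS -/(phase_val ph s i n) -/(phase_val ph s' i n) IH.
by rewrite envE // => a ai; rewrite mem_cat ai orbT.
Qed.

Lemma loop_size_le extent W ds : (forall d, extent d <= W)%N ->
  (loop_size extent ds <= W ^ size ds)%N.
Proof. by move=> le; elim: ds => //= d ds IH; rewrite expnS leq_mul. Qed.

Lemma phase_bits_mono ph W n1 n2 n1' n2' : (n1 <= n1')%N -> (n2 <= n2')%N ->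
  (phase_bits ph W n1 n2 <= phase_bits ph W n1' n2')%N.
Proof.
move=> l1 l2; apply: leq_mul; last lia.
by rewrite leq_add2l leq_mul2r l2 orbT.
Qed.

Lemma phase_cost_mono ph W n1 n2 n1' n2' : (n1 <= n1')%N -> (n2 <= n2')%N ->
  (phase_cost ph W n1 n2 <= phase_cost ph W n1' n2')%N.
Proof.
move=> l1 l2; rewrite /phase_cost; apply: leq_mul; last exact: phase_bits_mono.
by rewrite leq_mul // leq_mul // leq_add2r.
Qed.

Lemma poly_bounded_bits ph a b :
  poly_bounded (fun W => phase_bits ph W (W ^ a) (W ^ b)).
Proof.
by do ?[apply: poly_bounded_mul | apply: poly_bounded_add
       | exact: poly_bounded_const | exact: poly_bounded_id
       | exact: poly_bounded_exp].
Qed.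

Lemma poly_bounded_cost ph a b :
  poly_bounded (fun W => phase_cost ph W (W ^ a) (W ^ b)).
Proof.
by do ?[exact: poly_bounded_const | exact: poly_bounded_exp
       | exact: poly_bounded_bits | apply: poly_bounded_mul
       | apply: poly_bounded_add].
Qed.

(** Each phase replaces the bit bound by a polynomial in it, so the total time is a finite
    composition of polynomials. The function [f] is chosen before the instance and depends on the
    program alone. *)
Lemma exec_prog ph0 D ps : single_assignment D ps -> 0%N \in D ->
  all (fun a => a \notin D) [:: 20; 21; 22]%N ->
  exists2 f, poly_bounded f & forall extent W s,
    bounded W s -> (forall d, s 0%N d = (extent d)%:Z) ->
    (forall d, extent d <= W)%N ->
    exists t s', [/\ exec (prog_cmd ps) s t s', (t <= f W)%N,
      forall a k, kept D a k -> s' a k = s a k &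
      forall j, (j < size ps)%N -> solves extent s' (nth ph0 ps j)].
Proof.
elim: ps D => [|ph ps IH] D /=.
  move=> _ _ _; exists (fun=> 1%N); first exact: poly_bounded_const.
  by move=> extent W s bs sd dW; exists 1%N, s; split => //; exact: ExecSkip.
case/and4P=> tgt tD rd ok D0 tmpD.
have D0' : 0%N \in target ph :: D by rewrite inE D0 orbT.
have tmpD' : all (fun a => a \notin target ph :: D) [:: 20; 21; 22]%N.
  move: tgt tmpD; rewrite /= !inE !negb_or ![_ == target ph]eq_sym.
  by case/and3P=> -> -> ->.
have [f pf Hf] := IH _ ok D0' tmpD'.
pose a := size (outer ph); pose b := size (inner ph).
(* Adding [W] keeps the loop extents below the new bound. *)
pose g W := (W + phase_bits ph W (W ^ a) (W ^ b))%N.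
exists (fun W => phase_cost ph W (W ^ a) (W ^ b) + f (g W))%N.
  apply: poly_bounded_add; first exact: poly_bounded_cost.
  apply: poly_bounded_comp => // [|W W0]; last by rewrite /g addn_gt0 W0.
  apply: poly_bounded_add; [exact: poly_bounded_id|exact: poly_bounded_bits].
move=> extent W s bs sd dW.
have pok : phase_ok ph.
  move: tgt; rewrite /phase_ok !inE !negb_or => /and3P[t20 t21 t22].
  rewrite t20 t21 t22.
  have nt : target ph != 0%N by apply: contraNneq tD => ->.
  have nD c : c \notin 20%N :: 21%N :: D -> c \notin reads (init ph) ++ reads (body ph).
    by apply: contra => /(allP rd).
  rewrite nt /= !nD // !inE !negb_or ?t20 ?t21 ?tD //.
  by move: tmpD => /= /and4P[_ _ -> _].
have [t1 [s1 [ex1 le1 b1 [keep1 val1]]]] := exec_phase pok bs sd.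
have l1 := loop_size_le (outer ph) dW; have l2 := loop_size_le (inner ph) dW.
have bg : bounded (g W) s1.
  apply: bounded_le b1; apply: leq_trans (leq_addl _ _).
  exact: phase_bits_mono.
have kept1 c k : kept D c k -> s1 c k = s c k.
  move=> ck; apply: keep1; rewrite /fixed_cell !inE negb_or.
  case/orP: ck => [cD|/andP[ck k0]]; last first.
    rewrite k0 implybT andbT; move: ck tgt; rewrite !inE !negb_or.
    by case/orP=> /eqP -> /and3P[n20 n21 _]; rewrite eq_sym ?n20 ?n21.
  move: tmpD => /= /and4P[n20 n21 n22 _].
  have -> : (c == target ph) = false by apply: contraNF tD => /eqP <-.
  have -> : (c == 22%N) = false by apply: contraNF n22 => /eqP <-.
  have -> : (c == 20%N) = false by apply: contraNF n20 => /eqP <-.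
  by have -> : (c == 21%N) = false by apply: contraNF n21 => /eqP <-.
have sd1 d : s1 0%N d = (extent d)%:Z by rewrite kept1 // /kept D0.
have dg d : (extent d <= g W)%N by apply: leq_trans (dW d) (leq_addr _ _).
have [t2 [s2 [ex2 le2 keep2 val2]]] := Hf extent (g W) s1 bg sd1 dg.
have kept2 c k : kept D c k -> s2 c k = s c k.
  move=> ck; rewrite keep2 ?kept1 //; move: ck; rewrite /kept [c \in target ph :: D]inE.
  by case/orP=> ->; rewrite ?orbT.
exists (t1 + t2)%N, s2; split => //.
- exact: ExecSeq ex1 ex2.
- apply: leq_add le2; apply: leq_trans le1 _; exact: phase_cost_mono.
move=> [_|j /val2 //] i iN /=.
(* The equation of the head phase passes to the final store, since later phases alter neither its
   target nor the cells it reads. *)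
rewrite keep2 ?val1 ?(eq_phase_val _ _ rd kept2) //.
by rewrite /kept inE eqxx.
Qed.

(** * The program *)

Section FoldValues.

Variables (a : nat) (d1 d2 : seq nat) (e1 e2 : expr) (s : store) (i n : nat).

Lemma phase_val_add : phase_val (Phase a FoldAdd d1 d2 e1 e2) s i n =
  expr_val (env s i%:Z 0) e1 + \sum_(t < n) expr_val (env s i%:Z (t : nat)%:Z) e2.
Proof.
elim: n => [|k IH]; first by rewrite big_ord0 addr0.
by rewrite big_ord_recr /= addrA -IH.
Qed.

Lemma phase_val_mul : phase_val (Phase a FoldMul d1 d2 e1 e2) s i n =
  expr_val (env s i%:Z 0) e1 * \prod_(t < n) expr_val (env s i%:Z (t : nat)%:Z) e2.
Proof.
elim: n => [|k IH]; first by rewrite big_ord0 mulr1.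
by rewrite big_ord_recr /= mulrA -IH.
Qed.

Lemma phase_val_min (v := phase_val (Phase a FoldMin d1 d2 e1 e2) s i n) :
  [/\ v <= expr_val (env s i%:Z 0) e1,
      forall t : 'I_n, v <= expr_val (env s i%:Z (t : nat)%:Z) e2 &
      v = expr_val (env s i%:Z 0) e1 \/
      exists t : 'I_n, v = expr_val (env s i%:Z (t : nat)%:Z) e2].
Proof.
rewrite {}/v; elim: n => [|k [l1 l2 at_]].
  by split=> [||]; [exact: lexx|case|left].
rewrite /phase_val iteriS -/(phase_val (Phase a FoldMin d1 d2 e1 e2) s i k) /=.
set v := phase_val _ _ _ _ in l1 l2 at_ *; set w := expr_val _ _.
split=> [|t|].
- by rewrite ge_min l1.
- have : (t <= k)%N by rewrite -ltnS.
  rewrite leq_eqVlt => /orP[/eqP tk|tk].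
    by rewrite ge_min tk lexx orbT.
  by rewrite ge_min (l2 (Ordinal tk)).
case: (leP v w) => _; last by right; exists ord_max.
case: at_ => [->|[t ->]]; first by left.
by right; exists (widen_ord (leqnSn k) t).
Qed.

End FoldValues.

Definition Emax (e1 e2 : expr) : expr :=
  Bin Defs.Sub (Bin Add e1 e2) (Emin e1 e2).

Definition Eprec (v1 v2 e1 e2 : expr) : expr :=
  Bin Add (Elt v2 v1) (Bin Mul (Eeq v1 v2) (Elt e1 e2)).

Section Evaluation.

Variables (s : store).

Lemma Emax_val e1 e2 : expr_val s (Emax e1 e2)
  = Num.max (expr_val s e1) (expr_val s e2).
Proof.
change (expr_val s e1 + expr_val s e2 - expr_val s (Emin e1 e2) =
  Num.max (expr_val s e1) (expr_val s e2)).
by rewrite Emin_val -(addr_max_min (expr_val s e1)) addrK.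
Qed.

Lemma Eadd_val e1 e2 : expr_val s (Bin Add e1 e2) = expr_val s e1 + expr_val s e2.
Proof. by []. Qed.

Lemma Esub_val e1 e2 :
  expr_val s (Bin Defs.Sub e1 e2) = expr_val s e1 - expr_val s e2.
Proof. by []. Qed.

Lemma Emul_val e1 e2 : expr_val s (Bin Mul e1 e2) = expr_val s e1 * expr_val s e2.
Proof. by []. Qed.

Lemma Ediv_val e1 e2 :
  expr_val s (Bin Div e1 e2) = (expr_val s e1 %/ expr_val s e2)%Z.
Proof. by []. Qed.

Lemma Econst_val z : expr_val s (Const z) = z.
Proof. by []. Qed.

Lemma cell20_val i t : expr_val (env s i t) (cell 20) = i.
Proof. by []. Qed.

Lemma cell21_val i t : expr_val (env s i t) (cell 21) = t.
Proof. by []. Qed.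

Lemma Eread_val i t a e : a \notin [:: 20; 21]%N ->
  expr_val (env s i t) (Read a e) = s a `|expr_val (env s i t) e|%N.
Proof.
by rewrite !inE negb_or => /andP[/negPf n20 /negPf n21];
   rewrite /= /env /update n20 n21.
Qed.

Lemma mul_bool (b1 b2 : bool) : b1%:Z * b2%:Z = (b1 && b2)%:Z.
Proof. by case: b1; case: b2. Qed.

End Evaluation.

Definition evalE := (cell20_val, cell21_val, Elt_val, Ele_val, Eeq_val, Emin_val,
  Emax_val, Eadd_val, Esub_val, Emul_val, Ediv_val, Econst_val).

Section Program.

Local Notation "'#' z" := (Const (z%N : nat)%:Z) (at level 1, z at level 0).
Local Notation "a $[ e ]" := (Read a e) (at level 2, e at level 200, format "a $[ e ]").
Local Notation ei := (cell 20).
Local Notation et := (cell 21).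
Local Infix "+e" := (Bin Add) (at level 50, left associativity).
Local Infix "-e" := (Bin Defs.Sub) (at level 50, left associativity).
Local Infix "*e" := (Bin Mul) (at level 40, left associativity).
Local Infix "/e" := (Bin Div) (at level 40, left associativity).

Definition Erow (e : expr) (d : nat) : expr := e /e 0$[#d].
Definition Ecol (e : expr) (d : nat) : expr := e -e Erow e d *e 0$[#d].

Definition map_phase (a : nat) (d : seq nat) (e : expr) : phase :=
  Phase a FoldAdd d [::] e #0.
Definition sum_phase (a : nat) (d1 d2 : seq nat) (e1 e2 : expr) : phase :=
  Phase a FoldAdd d1 d2 e1 e2.
Definition prod_phase (a : nat) (d : seq nat) (e : expr) : phase :=
  Phase a FoldMul [::] d #1 e.
Definition min_phase (a : nat) (d1 d2 : seq nat) (e1 e2 : expr) : phase :=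
  Phase a FoldMin d1 d2 e1 e2.

(** Arrays 11 and 12 hold [stair] and the cost, numerator and denominator of an entry of [x], so
    comparing the entry with 0 and 1 is an integer test. *)
Definition Efrac (e : expr) : expr := Elt #0 11$[e] *e Elt 11$[e] 12$[e].
Definition Ewhole (e : expr) : expr := Eeq 11$[e] 12$[e].
(** Array 15 marks only fractional pairs, so fractionality is not tested again. *)
Definition Esplit2 (e : expr) : expr := 15$[e] *e Enot 56$[Ecol e 1].
Definition Esplit3 (e : expr) : expr := 15$[e] *e 56$[Ecol e 1].
Definition Eprofit (b e : expr) : expr := b *e 34$[Erow e 1].

Definition Emark (j k : expr) : expr :=
  Elt #0 51$[j] *e (Elt 40$[k] (48$[j] +e 47$[j])
                    *e Ele (48$[j] +e 47$[j]) (40$[k] +e 39$[k]))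
  +e Ele 51$[j] #0 *e (Ele 40$[k] 48$[j] *e Elt 48$[j] (40$[k] +e 39$[k])).

Definition Eoverlap (j k : expr) : expr :=
  Emax #0 (Emin (48$[j] +e 47$[j]) (40$[k] +e 39$[k]) -e Emax 48$[j] 40$[k]).

Definition Ebest1 : expr := Ele 54$[#0] 53$[#0] *e Ele 55$[#0] 53$[#0].
Definition Ebest2 : expr := Ele 55$[#0] 54$[#0].

(* Arrays, for items [i], [j] and knapsacks [k] (pairs are stored row by row):
   33 common denominator, by which all data are scaled;
   34 profits; 35 costs; 36 capacities; 37 cluster capacities; 38 [used];
   39 [eff]; 40 start of [k] on the line; 41 [room] above the cost of [i];
   42 density rank; 43 and 45 the cuts of the items ranked before [j];
   44 and 46 [greedy_rank] before and after [j]; 47 [greedy]; 48 start of [j];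
   49 total of [greedy] over costs at least that of [i]; 50 number of tight
   thresholds between [j] and [i]; 51 positive when [j] is [late];
   53 to 55 values of the candidates; 56 [critical].
   The numbers in the margin are positions in the list. *)
Definition algorithm : seq phase := [::
  (* 0 *) prod_phase 30 [:: 0%N] (2$[et] *e 4$[et]);
  prod_phase 31 [:: 1%N] 6$[et];
  prod_phase 32 [:: 2%N] 9$[et];
  map_phase 33 [::] (30$[#0] *e 31$[#0] *e 32$[#0]);
  map_phase 34 [:: 0%N] (1$[ei] *e 33$[#0] /e 2$[ei]);
  (* 5 *) map_phase 35 [:: 0%N] (3$[ei] *e 33$[#0] /e 4$[ei]);
  map_phase 36 [:: 1%N] (5$[ei] *e 33$[#0] /e 6$[ei]);
  map_phase 37 [:: 2%N] (8$[ei] *e 33$[#0] /e 9$[ei]);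
  sum_phase 10 [:: 1%N] [:: 1%N] #1
    (Eeq 7$[et] 7$[ei] *e Eprec 36$[et] 36$[ei] et ei);
  sum_phase 38 [:: 1%N] [:: 1%N] #0
    (Eeq 7$[et] 7$[ei] *e Elt 10$[et] 10$[ei] *e 36$[et]);
  (* 10 *) map_phase 39 [:: 1%N]
    (Emax #0 (Emin 36$[ei] (37$[7$[ei]] -e 38$[ei])));
  sum_phase 40 [:: 1%N] [:: 1%N] #0 (Eprec 36$[et] 36$[ei] et ei *e 39$[et]);
  sum_phase 41 [:: 0%N] [:: 1%N] #0 (Ele 35$[ei] 36$[et] *e 39$[et]);
  sum_phase 42 [:: 0%N] [:: 0%N] #0
    (Eprec (34$[et] *e 35$[ei]) (34$[ei] *e 35$[et]) et ei);
  sum_phase 43 [:: 0; 0]%N [:: 0%N] 41$[Ecol ei 0]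
    (Elt 42$[et] 42$[Erow ei 0] *e Elt 35$[et] 35$[Ecol ei 0] *e 35$[et]);
  (* 15 *) sum_phase 45 [:: 0%N] [:: 0%N] #0 (Elt 42$[et] 42$[ei] *e 35$[et]);
  min_phase 44 [:: 0%N] [:: 0%N] 45$[ei] 43$[ei *e 0$[#0] +e et];
  min_phase 46 [:: 0%N] [:: 0%N] (45$[ei] +e 35$[ei])
    (43$[ei *e 0$[#0] +e et] +e Elt 35$[ei] 35$[et] *e 35$[ei]);
  map_phase 47 [:: 0%N] (46$[ei] -e 44$[ei]);
  sum_phase 48 [:: 0%N] [:: 0%N] #0 (Eprec 35$[et] 35$[ei] et ei *e 47$[et]);
  (* 20 *) sum_phase 49 [:: 0%N] [:: 0%N] #0 (Ele 35$[ei] 35$[et] *e 47$[et]);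
  sum_phase 50 [:: 0; 0]%N [:: 0%N] #0
    (Elt 35$[Erow ei 0] 35$[et] *e Ele 35$[et] 35$[Ecol ei 0]
     *e Eeq 49$[et] 41$[et]);
  sum_phase 51 [:: 0%N] [:: 0%N] #0
    (Elt #0 47$[et] *e Elt 47$[et] 35$[et]
     *e (Eeq et ei +e Eprec 35$[et] 35$[ei] et ei)
     *e Eeq 50$[ei *e 0$[#0] +e et] #0);
  map_phase 11 [:: 0; 1]%N (Eoverlap (Erow ei 1) (Ecol ei 1));
  map_phase 12 [:: 0; 1]%N 35$[Erow ei 1];
  (* 25 *) map_phase 13 [:: 0; 1]%N 11$[ei];
  map_phase 14 [:: 0; 1]%N 12$[ei];
  map_phase 56 [:: 1%N]
    (Ele 38$[ei] 37$[7$[ei]] *e Elt 37$[7$[ei]] (38$[ei] +e 36$[ei]));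
  map_phase 15 [:: 0; 1]%N (Efrac ei *e Emark (Erow ei 1) (Ecol ei 1));
  sum_phase 53 [::] [:: 0; 1]%N #0 (Eprofit (Ewhole et) et);
  (* 30 *) sum_phase 54 [::] [:: 0; 1]%N #0 (Eprofit (Esplit2 et) et);
  sum_phase 55 [::] [:: 0; 1]%N #0 (Eprofit (Esplit3 et) et);
  map_phase 16 [:: 0; 1]%N
    (Ebest1 *e Ewhole ei +e
     Enot Ebest1 *e (Ebest2 *e Esplit2 ei +e Enot Ebest2 *e Esplit3 ei))
].

Lemma algorithm_single_assignment : single_assignment (iota 0 10) algorithm.
Proof. by vm_compute. Qed.

Lemma algorithm_poly : exists2 f, poly_bounded f &
  forall extent W s, bounded W s -> (forall d, s 0%N d = (extent d)%:Z) ->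
    (forall d, extent d <= W)%N ->
    exists t s', [/\ exec (prog_cmd algorithm) s t s', (t <= f W)%N,
      forall a k, (a < 10)%N -> s' a k = s a k &
      forall j, (j < size algorithm)%N ->
        solves extent s' (nth (map_phase 0 [::] #0) algorithm j)].
Proof.
have [||f pf Hf] := exec_prog (map_phase 0 [::] #0) algorithm_single_assignment.
- by [].
- by [].
exists f => // extent W s bs sd dW.
have [t [s' [ex le kp val]]] := Hf extent W s bs sd dW.
exists t, s'; split => // a k a10; apply: kp.
by rewrite /kept mem_iota add0n a10.
Qed.

End Program.

(** * Correctness of the program *)

Ltac evaluate :=
  repeat first [rewrite evalE | rewrite Eread_val; [|by []]
    | rewrite absz_nat].

Section Instance.

Variables (m p q : nat) (I : mkpc rat m p q).

Definition extent (d : nat) : nat := nth 0%N [:: m; p; q] d.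

Lemma tabulateE n (F : 'I_n -> int) (i : 'I_n) : tabulate F i = F i.
Proof. by rewrite /tabulate valK. Qed.

Lemma size_le_sum n (F : 'I_n -> nat) :
  (forall i, (0 < F i)%N) -> (n <= \sum_(i < n) F i)%N.
Proof.
move=> F0; rewrite -[X in (X <= _)%N]card_ord -sum1_card.
by apply: leq_sum.
Qed.

Lemma extent_le d : (extent d <= input_size I)%N.
Proof.
have lm : (m <= \sum_(j < m) (rat_bits (profit I j) + rat_bits (cost I j)))%N.
  exact: size_le_sum.
have lp : (p <= \sum_(k < p) (rat_bits (capa I k) + nbits (clus I k : nat)%:Z))%N.
  exact: size_le_sum.
have lq : (q <= \sum_(l < q) rat_bits (ucap I l))%N by exact: size_le_sum.
case: d => [|[|[|d]]]; rewrite /extent /input_size [nth _ _ _]/=.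
1-3: lia.
by rewrite nth_nil.
Qed.

Lemma nbits_tabulate n (F : 'I_n -> int) W i : (0 < W)%N ->
  (forall j, nbits (F j) <= W)%N -> (nbits (tabulate F i) <= W)%N.
Proof.
move=> W0 FW; rewrite /tabulate; case: insubP => [j _ _|_] /=; first exact: FW.
by apply: nbits_le => //; rewrite expn_gt0.
Qed.

Lemma bounded_encode : bounded (input_size I) (encode I).
Proof.
have W0 : (0 < input_size I)%N by [].
have nb0 : (nbits 0 <= input_size I)%N by apply: nbits_le => //; rewrite expn_gt0.
have lej j : (rat_bits (profit I j) + rat_bits (cost I j) <= input_size I)%N.
  by rewrite /input_size (bigD1 j) //=; lia.
have lek k : (rat_bits (capa I k) + nbits (clus I k : nat)%:Z <= input_size I)%N.
  by rewrite /input_size [X in (_ + X + _)%N](bigD1 k) //=; lia.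
have lel l : (rat_bits (ucap I l) <= input_size I)%N.
  by rewrite /input_size [X in (_ <= _ + X)%N](bigD1 l) //=; lia.
move=> a i; case: a => [|[|[|[|[|[|[|[|[|[|a]]]]]]]]]] /=; last exact: nb0.
- by case: i => [|[|[|i]]] /=; rewrite ?nth_nil // /input_size; lia.
all: apply: nbits_tabulate => // j.
all: rewrite /rat_bits in lej lek lel.
all: first [have := lej j | have := lek j | have := lel j]; lia.
Qed.

End Instance.

Section Solution.

Variables (m p q : nat) (I : mkpc rat m p q).
Hypothesis vI : mkpc_valid I.
Variable s : store.
Hypothesis s_in : forall a k, (a < 10)%N -> s a k = encode I a k.
Hypothesis s_eq : forall j, (j < size algorithm)%N ->
  solves (extent m p q) s (nth (map_phase 0 [::] (Const 0)) algorithm j).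

Let dims_m : loop_size (extent m p q) [:: 0%N] = m. Proof. exact: muln1. Qed.
Let dims_p : loop_size (extent m p q) [:: 1%N] = p. Proof. exact: muln1. Qed.
Let dims_q : loop_size (extent m p q) [:: 2%N] = q. Proof. exact: muln1. Qed.
Let dims_mm : loop_size (extent m p q) [:: 0; 0]%N = (m * m)%N.
Proof. by rewrite /= muln1. Qed.
Let dims_mp : loop_size (extent m p q) [:: 0; 1]%N = (m * p)%N.
Proof. by rewrite /= muln1. Qed.

Lemma map_solve a d e n : solves (extent m p q) s (map_phase a d e) ->
  loop_size (extent m p q) d = n -> forall i, (i < n)%N ->
  s a i = expr_val (env s i%:Z 0) e.
Proof.
by move=> sol <- i iN; rewrite (sol i iN) phase_val_add big_ord1 /= addr0.
Qed.

Lemma sum_solve a d1 d2 e1 e2 n1 n2 :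
  solves (extent m p q) s (sum_phase a d1 d2 e1 e2) ->
  loop_size (extent m p q) d1 = n1 -> loop_size (extent m p q) d2 = n2 ->
  forall i, (i < n1)%N -> s a i = expr_val (env s i%:Z 0) e1 +
    \sum_(t < n2) expr_val (env s i%:Z (t : nat)%:Z) e2.
Proof. by move=> sol <- <- i iN; rewrite (sol i iN) phase_val_add. Qed.

Lemma prod_solve a d e n : solves (extent m p q) s (prod_phase a d e) ->
  loop_size (extent m p q) d = n ->
  s a 0%N = \prod_(t < n) expr_val (env s 0 (t : nat)%:Z) e.
Proof. by move=> sol <-; rewrite (sol 0%N isT) phase_val_mul mul1r. Qed.

Lemma min_solve a d1 d2 e1 e2 n1 n2 :
  solves (extent m p q) s (min_phase a d1 d2 e1 e2) ->
  loop_size (extent m p q) d1 = n1 -> loop_size (extent m p q) d2 = n2 ->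
  forall i, (i < n1)%N ->
  [/\ s a i <= expr_val (env s i%:Z 0) e1,
      forall t : 'I_n2, s a i <= expr_val (env s i%:Z (t : nat)%:Z) e2 &
      s a i = expr_val (env s i%:Z 0) e1 \/
      exists t : 'I_n2, s a i = expr_val (env s i%:Z (t : nat)%:Z) e2].
Proof. by move=> sol <- <- i iN; rewrite (sol i iN); apply: phase_val_min. Qed.

(** * Scaling the data to integers *)

Definition den : int := s 33 0.

Lemma in1 (j : 'I_m) : s 1 j = numq (profit I j). Proof. by rewrite s_in //= tabulateE. Qed.
Lemma in2 (j : 'I_m) : s 2 j = denq (profit I j). Proof. by rewrite s_in //= tabulateE. Qed.
Lemma in3 (j : 'I_m) : s 3 j = numq (cost I j). Proof. by rewrite s_in //= tabulateE. Qed.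
Lemma in4 (j : 'I_m) : s 4 j = denq (cost I j). Proof. by rewrite s_in //= tabulateE. Qed.
Lemma in5 (k : 'I_p) : s 5 k = numq (capa I k). Proof. by rewrite s_in //= tabulateE. Qed.
Lemma in6 (k : 'I_p) : s 6 k = denq (capa I k). Proof. by rewrite s_in //= tabulateE. Qed.
Lemma in7 (k : 'I_p) : s 7 k = (clus I k : nat)%:Z. Proof. by rewrite s_in //= tabulateE. Qed.
Lemma in8 (l : 'I_q) : s 8 l = numq (ucap I l). Proof. by rewrite s_in //= tabulateE. Qed.
Lemma in9 (l : 'I_q) : s 9 l = denq (ucap I l). Proof. by rewrite s_in //= tabulateE. Qed.

Lemma denE : den = (\prod_(j < m) (denq (profit I j) * denq (cost I j)))
  * (\prod_(k < p) denq (capa I k)) * (\prod_(l < q) denq (ucap I l)).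
Proof.
rewrite /den (map_solve (s_eq (isT : 3 < 33)%N) erefl) //.
evaluate.
rewrite (prod_solve (s_eq (isT : 0 < 33)%N) dims_m).
rewrite (prod_solve (s_eq (isT : 1 < 33)%N) dims_p).
rewrite (prod_solve (s_eq (isT : 2 < 33)%N) dims_q).
congr (_ * _ * _); apply: eq_bigr => t _;
  by evaluate; rewrite ?in2 ?in4 ?in6 ?in9.
Qed.

Lemma den_gt0 : 0 < den.
Proof. by rewrite denE !mulr_gt0 // prodr_gt0 // => i _; rewrite ?mulr_gt0. Qed.

(** Sums, differences, minima, maxima and comparisons commute with a common positive factor. Apart
    from densities the compared quantities are built by these alone, so integer arithmetic is
    exact. *)
Definition scales (z : int) (v : rat) : Prop := z%:~R = v * den%:~R.

Lemma scales_num r : (denq r %| den)%Z -> scales (numq r * den %/ denq r)%Z r.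
Proof.
case/dvdzP=> x Ex; rewrite /scales Ex mulrA mulzK //.
by rewrite !rmorphM /= numqE; ring.
Qed.

Lemma dvd_prod n (F : 'I_n -> int) i : (F i %| \prod_(j < n) F j)%Z.
Proof. by rewrite (bigD1 i) //= dvdz_mulr. Qed.

Lemma scales_profit (j : 'I_m) : scales (s 34 j) (profit I j).
Proof.
rewrite (map_solve (s_eq (isT : 4 < 33)%N) dims_m) //; evaluate.
rewrite in1 in2; apply: scales_num; rewrite denE -mulrA dvdz_mulr //.
exact: dvdz_trans (dvdz_mulr _ (dvdzz _)) (dvd_prod _ j).
Qed.

Lemma scales_cost (j : 'I_m) : scales (s 35 j) (cost I j).
Proof.
rewrite (map_solve (s_eq (isT : 5 < 33)%N) dims_m) //; evaluate.
rewrite in3 in4; apply: scales_num; rewrite denE -mulrA dvdz_mulr //.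
exact: dvdz_trans (dvdz_mull _ (dvdzz _)) (dvd_prod _ j).
Qed.

Lemma scales_capa (k : 'I_p) : scales (s 36 k) (capa I k).
Proof.
rewrite (map_solve (s_eq (isT : 6 < 33)%N) dims_p) //; evaluate.
rewrite in5 in6; apply: scales_num; rewrite denE dvdz_mulr // dvdz_mull //.
exact: (dvd_prod (fun k => denq (capa I k))).
Qed.

Lemma scales_ucap (l : 'I_q) : scales (s 37 l) (ucap I l).
Proof.
rewrite (map_solve (s_eq (isT : 7 < 33)%N) dims_q) //; evaluate.
rewrite in8 in9; apply: scales_num; rewrite denE dvdz_mull //.
exact: (dvd_prod (fun k => denq (ucap I k))).
Qed.

Let den_gt0q : 0 < den%:~R :> rat. Proof. by rewrite ltr0z den_gt0. Qed.

Lemma scales_lt z v z' v' : scales z v -> scales z' v' -> (z < z') = (v < v').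
Proof. by move=> E E'; rewrite -(ltr_int rat) E E' ltr_pM2r. Qed.

Lemma scales_le z v z' v' : scales z v -> scales z' v' -> (z <= z') = (v <= v').
Proof. by move=> E E'; rewrite !leNgt (scales_lt E' E). Qed.

Lemma scales_eq z v z' v' : scales z v -> scales z' v' -> (z == z') = (v == v').
Proof. by move=> E E'; rewrite !eq_le (scales_le E E') (scales_le E' E). Qed.

Lemma scales0 : scales 0 0.
Proof. by rewrite /scales mul0r. Qed.

Lemma scales_add z v z' v' : scales z v -> scales z' v' -> scales (z + z') (v + v').
Proof. by rewrite /scales rmorphD /= mulrDl => -> ->. Qed.

Lemma scales_sub z v z' v' : scales z v -> scales z' v' -> scales (z - z') (v - v').
Proof. by rewrite /scales rmorphB /= mulrBl => -> ->. Qed.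

Lemma scales_min z v z' v' : scales z v -> scales z' v' ->
  scales (Num.min z z') (Num.min v v').
Proof. by move=> E E'; rewrite !minEle (scales_le E E'); case: ifP. Qed.

Lemma scales_max z v z' v' : scales z v -> scales z' v' ->
  scales (Num.max z z') (Num.max v v').
Proof. by move=> E E'; rewrite !maxEle (scales_le E E'); case: ifP. Qed.

Lemma scales_if (b : bool) z v : scales z v -> scales (b%:Z * z) (if b then v else 0).
Proof. by case: b => E; rewrite ?mul1r ?mul0r //; apply: scales0. Qed.

Lemma scales_sum n (P : pred 'I_n) (F : 'I_n -> int) (G : 'I_n -> rat) :
  (forall t, scales (F t) (if P t then G t else 0)) ->
  scales (\sum_(t < n) F t) (\sum_(t | P t) G t).
Proof.
move=> FG; rewrite /scales rmorph_sum /= [X in _ = X * _]big_mkcond mulr_suml.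
by apply: eq_bigr => t _; apply: FG.
Qed.

Lemma prec_val n (a : nat) (v : 'I_n -> rat) (i j : 'I_n) :
  (forall i : 'I_n, scales (s a i) (v i)) ->
  ((s a j < s a i)%R : bool)%:Z
  + (s a i == s a j : bool)%:Z * (((i : nat)%:Z < (j : nat)%:Z)%R : bool)%:Z
    = (prec v i j)%:Z.
Proof.
move=> E; rewrite ltz_nat (scales_lt (E j) (E i)) (scales_eq (E i) (E j)) /prec.
by case: ltgtP => _ /=; rewrite ?mul0r ?mul1r.
Qed.

Definition pos_in_cluster (k : 'I_p) : nat := (rank (capa I) (clus I) k).+1.

Lemma pos_in_cluster_indexing : indexing I pos_in_cluster.
Proof.
split.
- move=> k; rewrite /pos_in_cluster /rank; apply: proper_card.
  apply/properP; split; first by apply/subsetP => t; rewrite !inE => /andP[].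
  by exists k; rewrite !inE eqxx ?precxx.
- by move=> k t ckt [] /(rank_inj ckt).
by move=> k t ckt; rewrite ltnS; apply: rank_le.
Qed.

Let pi := pos_in_cluster.
Let ixpi : indexing I pi := pos_in_cluster_indexing.
Let B := capa I.
Let C := eff I pi.
Let c := cost I.
Let Cap (i : 'I_m) := room B C (c i).
Definition density (j : 'I_m) : rat := profit I j / cost I j.
Definition density_rank : 'I_m -> nat := rank density (fun=> tt).
Let rk := density_rank.
Let d := greedy rk c Cap.
Let C_ge0 : forall k, 0 <= C k := eff_ge0 vI ixpi.
Let c_gt0 : forall j, 0 < c j := cost_gt0 vI.
Let c_ge0 j : 0 <= c j. Proof. exact/ltW/c_gt0. Qed.

Lemma store_pos (k : 'I_p) : s 10 k = (pi k)%:Z.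
Proof.
rewrite (sum_solve (s_eq (isT : 8 < 33)%N) dims_p dims_p) //; evaluate.
rewrite [RHS]intS; congr (_ + _).
rewrite /rank -sum1_card [X in _ = Posz X]big_mkcond.
rewrite (big_morph Posz PoszD (erefl _)).
apply: eq_bigr => t _; rewrite inE; evaluate.
rewrite (prec_val _ _ scales_capa) !in7 mul_bool eqz_nat (inj_eq val_inj).
by case: ifP.
Qed.

Lemma store_used (k : 'I_p) : scales (s 38 k) (used I pi k).
Proof.
rewrite (sum_solve (s_eq (isT : 9 < 33)%N) dims_p dims_p) //; evaluate.
rewrite add0r; apply: scales_sum => t; evaluate.
rewrite !in7 !store_pos mul_bool eqz_nat (inj_eq val_inj) ltz_nat.
exact: scales_if (scales_capa t).
Qed.

Lemma store_critical (k : 'I_p) : s 56 k = (critical I pi k)%:Z.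
Proof.
rewrite (map_solve (s_eq (isT : 27 < 33)%N) dims_p) //; evaluate.
rewrite in7 absz_nat mul_bool (criticalE ixpi).
by rewrite (scales_le (store_used k) (scales_ucap _))
  (scales_lt (scales_ucap _) (scales_add (store_used k) (scales_capa k))).
Qed.

Lemma store_eff (k : 'I_p) : scales (s 39 k) (C k).
Proof.
rewrite (map_solve (s_eq (isT : 10 < 33)%N) dims_p) //; evaluate.
rewrite in7 absz_nat.
(* Clipping the remaining cluster capacity to the interval from 0 to [B k] merges the cases before,
   at and after the critical knapsack. *)
have -> : C k = Num.max 0 (Num.min (capa I k) (ucap I (clus I k) - used I pi k)).
  rewrite /C (effE vI ixpi); have := capa_gt0 vI k; rewrite -lerBrDl.
  rewrite minEle; case: ifP => [_ B0|_ B0]; first by rewrite max_r // ltW.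
  rewrite -subr_ge0 maxEle; case: ifP => // /negbT; rewrite -ltNge => lt0.
exact: scales_max scales0 (scales_min (scales_capa k)
  (scales_sub (scales_ucap _) (store_used k))).
Qed.

Lemma store_start_knapsack (k : 'I_p) : scales (s 40 k) (start B C k).
Proof.
rewrite (sum_solve (s_eq (isT : 11 < 33)%N) dims_p dims_p) //; evaluate.
rewrite add0r; apply: scales_sum => t; evaluate.
rewrite (prec_val _ _ scales_capa); exact: scales_if (store_eff t).
Qed.

Lemma store_room (i : 'I_m) : scales (s 41 i) (Cap i).
Proof.
rewrite (sum_solve (s_eq (isT : 12 < 33)%N) dims_m dims_p) //; evaluate.
rewrite add0r; apply: scales_sum => t; evaluate.
rewrite (scales_le (scales_cost i) (scales_capa t)).
exact: scales_if (store_eff t).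
Qed.
Lemma store00 : s 0 0 = m%:Z. Proof. by rewrite s_in. Qed.
Lemma store01 : s 0 1 = p%:Z. Proof. by rewrite s_in. Qed.

Lemma pair_lt a n j (i : 'I_n) : (j < a)%N -> (j * n + i < a * n)%N.
Proof.
move=> ja; apply: leq_trans (leq_mul ja (leqnn n)).
by rewrite mulSn addnC ltn_add2r.
Qed.

Lemma pair_row n (j : nat) (i : 'I_n) : ((j * n + i)%N%:Z %/ n%:Z)%Z = j%:Z.
Proof.
have n0 : (0 < n)%N by apply: leq_ltn_trans (ltn_ord i).
by rewrite divz_nat divnMDl // divn_small ?addn0.
Qed.

Lemma pair_col n (j : nat) (i : 'I_n) :
  (j * n + i)%N%:Z - j%:Z * n%:Z = (i : nat)%:Z.
Proof. by rewrite PoszD PoszM addrC addKr. Qed.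

Lemma pair_index (j i n : nat) : j%:Z * n%:Z + i%:Z = (j * n + i)%N%:Z.
Proof. by rewrite PoszD PoszM. Qed.

Let pairE := (store00, store01, pair_row, pair_col, pair_index, absz_nat).

(** Cross-multiplication: both products carry the square of [den], which cancels. *)
Lemma density_lt (j t : 'I_m) :
  (s 34 j * s 35 t < s 34 t * s 35 j) = (density j < density t).
Proof.
have cj := cost_gt0 vI j; have ct := cost_gt0 vI t.
rewrite -(ltr_int rat) !rmorphM /= !scales_profit !scales_cost.
rewrite !(mulrACA _ _ (cost I _)) ltr_pM2r ?mulr_gt0 //.
by rewrite /density ltr_pdivrMr // mulrAC ltr_pdivlMr.
Qed.

Lemma store_rank (j : 'I_m) : s 42 j = (rk j)%:Z.
Proof.
rewrite (sum_solve (s_eq (isT : 13 < 33)%N) dims_m dims_m) //; evaluate.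
rewrite add0r /rk /density_rank /rank -sum1_card [X in _ = Posz X]big_mkcond.
rewrite (big_morph Posz PoszD (erefl _)); apply: eq_bigr => t _.
rewrite inE eqxx; evaluate.
rewrite ltz_nat density_lt eq_le !leNgt !density_lt -!leNgt -eq_le /prec.
by case: ltgtP => //= _; rewrite ?mul0r ?mul1r //; case: ifP.
Qed.

Lemma store_cut (j i : 'I_m) :
  scales (s 43 (j * m + i)%N) (cut c Cap (Some i) (below rk (rk j))).
Proof.
rewrite (sum_solve (s_eq (isT : 14 < 33)%N) dims_mm dims_m) ?pair_lt //; evaluate.
rewrite !pairE; apply: scales_add (store_room i) _; apply: scales_sum => t.
evaluate; rewrite !pairE !store_rank ltz_nat mul_bool.
rewrite (scales_lt (scales_cost t) (scales_cost i)).
exact: scales_if (scales_cost t).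
Qed.

Lemma store_cut_all (j : 'I_m) : scales (s 45 j) (cut c Cap None (below rk (rk j))).
Proof.
rewrite (sum_solve (s_eq (isT : 15 < 33)%N) dims_m dims_m) //; evaluate.
rewrite add0r; apply: scales_sum => t.
evaluate; rewrite !store_rank ltz_nat; exact: scales_if (scales_cost t).
Qed.

Lemma scales_greedy_rank z (zc : option 'I_m -> int) A :
  (forall o, scales (zc o) (cut c Cap o A)) -> (forall o, z <= zc o) ->
  (exists o, z = zc o) -> scales z (greedy_rank c Cap A).
Proof.
move=> E le [o Ez]; suff -> : greedy_rank c Cap A = cut c Cap o A by rewrite Ez.
apply/eqP; rewrite eq_le greedy_rank_le /=.
have [o' ->] := greedy_rank_attained c Cap A.
by rewrite -(scales_le (E o) (E o')) -Ez.
Qed.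

Let zcut (j : 'I_m) (o : option 'I_m) : int :=
  if o is Some i then s 43 (j * m + i)%N else s 45 j.

Let scales_zcut j o : scales (zcut j o) (cut c Cap o (below rk (rk j))).
Proof. by case: o => [i|]; [exact: store_cut|exact: store_cut_all]. Qed.

Lemma store_rank_before (j : 'I_m) :
  scales (s 44 j) (greedy_rank c Cap (below rk (rk j))).
Proof.
have [] := min_solve (s_eq (isT : 16 < 33)%N) dims_m dims_m (ltn_ord j).
evaluate => l1 l2 at_; apply: (@scales_greedy_rank _ (zcut j)) => [o|o|].
- exact: scales_zcut.
- by case: o => [i|//]; have := l2 i; evaluate; rewrite !pairE.
case: at_ => [->|[i ->]]; first by exists None.
by exists (Some i); evaluate; rewrite !pairE.
Qed.

Lemma rk_inj : injective rk.
Proof. by move=> i j; apply: rank_inj. Qed.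

(** No new cuts are tabulated: by [cut_add] those of the set enlarged by [j] arise from array 43 by
    adding the cost of [j] where it is counted. *)
Lemma store_rank_after (j : 'I_m) :
  scales (s 46 j) (greedy_rank c Cap (below rk (rk j).+1)).
Proof.
rewrite (eq_greedy_rank c Cap (below_add rk_inj j)).
have nj : ~~ below rk (rk j) j by rewrite /below ltnn.
have [] := min_solve (s_eq (isT : 17 < 33)%N) dims_m dims_m (ltn_ord j).
evaluate => l1 l2 at_.
pose zc o := zcut j o + (counted c o j)%:Z * s 35 j.
have ev (i : 'I_m) : zc (Some i) = s 43 (j * m + i)%N
    + ((s 35 j < s 35 i)%R : bool)%:Z * s 35 j.
  by rewrite (scales_lt (scales_cost j) (scales_cost i)).
apply: (@scales_greedy_rank _ zc) => [o|o|].
- rewrite cut_add //; apply: scales_add (scales_zcut j o) _.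
  exact: scales_if (scales_cost j).
- case: o => [i|]; last by rewrite /zc mul1r.
  by have := l2 i; evaluate; rewrite !pairE ev.
case: at_ => [->|[i ->]]; first by exists None; rewrite /zc mul1r.
by exists (Some i); evaluate; rewrite !pairE ev.
Qed.

Lemma store_greedy (j : 'I_m) : scales (s 47 j) (d j).
Proof.
rewrite (map_solve (s_eq (isT : 18 < 33)%N) dims_m) //; evaluate.
exact: scales_sub (store_rank_after j) (store_rank_before j).
Qed.

Lemma store_start_item (j : 'I_m) : scales (s 48 j) (start c d j).
Proof.
rewrite (sum_solve (s_eq (isT : 19 < 33)%N) dims_m dims_m) //; evaluate.
rewrite add0r; apply: scales_sum => t; evaluate.
rewrite (prec_val _ _ scales_cost); exact: scales_if (store_greedy t).
Qed.

Lemma store_tight (i : 'I_m) : (s 49 i == s 41 i) = tight c d B C i.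
Proof.
have E : scales (s 49 i) (\sum_(t | c i <= c t) d t).
  rewrite (sum_solve (s_eq (isT : 20 < 33)%N) dims_m dims_m) //; evaluate.
  rewrite add0r; apply: scales_sum => t; evaluate.
  rewrite (scales_le (scales_cost i) (scales_cost t)).
  exact: scales_if (store_greedy t).
exact: scales_eq E (store_room i).
Qed.

Lemma sum_bool n (b : 'I_n -> bool) :
  (\sum_(i < n) (b i)%:Z == 0) = ~~ [exists i, b i].
Proof.
rewrite psumr_eq0 // -[RHS]negbK negbK negb_exists.
apply/allP/forallP => [H i|H i _]; first by have := H i (mem_index_enum _); case: (b i).
by have := H i; case: (b i).
Qed.

Lemma store_late (j : 'I_m) : (0 < s 51 j) = late c d B C j.
Proof.
rewrite (sum_solve (s_eq (isT : 22 < 33)%N) dims_m dims_m) //; evaluate.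
rewrite add0r.
have -> : \sum_(t < m) expr_val (env s (j : nat)%:Z (t : nat)%:Z)
     (body (nth (map_phase 0 [::] (Const 0)) algorithm 22)) =
   \sum_(t < m) ([&& partial c d t, (t == j) || prec c t j
     & ~~ [exists i, [&& c j < c i, c i <= c t & tight c d B C i]]])%:Z.
  apply: eq_bigr => a _.
  have bad : (s 50 (j * m + a)%N == 0) =
      ~~ [exists i, [&& c j < c i, c i <= c a & tight c d B C i]].
    rewrite (sum_solve (s_eq (isT : 21 < 33)%N) dims_mm dims_m) ?pair_lt //.
    evaluate; rewrite add0r -sum_bool; congr (_ == 0); apply: eq_bigr => i _.
    evaluate; rewrite !pairE !mul_bool store_tight -andbA.
    by rewrite (scales_lt (scales_cost j) (scales_cost i))
      (scales_le (scales_cost i) (scales_cost a)).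
  rewrite [body _]/=; evaluate; rewrite !pairE bad (prec_val _ _ scales_cost).
  rewrite (scales_lt scales0 (store_greedy a)).
  rewrite (scales_lt (store_greedy a) (scales_cost a)).
  rewrite eqz_nat (inj_eq val_inj) -/c /partial -!mul_bool !mulrA.
  congr (_ * _ * _ * _).
  (* The disjunction is stored as a sum; irreflexivity of [prec] keeps it at most 1. *)
  by case: (eqVneq a j) => [->|_]; rewrite ?precxx.
by rewrite lt0r sum_bool sumr_ge0 // andbT negbK.
Qed.

Lemma store_stair (j : 'I_m) (k : 'I_p) :
  scales (s 11 (j * p + k)%N) (stair c d B C j k).
Proof.
rewrite (map_solve (s_eq (isT : 23 < 33)%N) dims_mp) ?pair_lt //; evaluate.
rewrite !pairE; apply: scales_max scales0 _; apply: scales_sub.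
  apply: scales_min; first exact: scales_add (store_start_item j) (store_greedy j).
  exact: scales_add (store_start_knapsack k) (store_eff k).
exact: scales_max (store_start_item j) (store_start_knapsack k).
Qed.

Lemma store_item_cost (j : 'I_m) (k : 'I_p) : scales (s 12 (j * p + k)%N) (c j).
Proof.
rewrite (map_solve (s_eq (isT : 24 < 33)%N) dims_mp) ?pair_lt //; evaluate.
by rewrite !pairE; exact: scales_cost.
Qed.

Let frac_val (j : 'I_m) (k : 'I_p) :
  (0 < s 11 (j * p + k)%N) && (s 11 (j * p + k)%N < s 12 (j * p + k)%N)
    = fractional c d B C j k.
Proof.
by rewrite (scales_lt scales0 (store_stair j k))
  (scales_lt (store_stair j k) (store_item_cost j k)).
Qed.

Lemma store_mark (j : 'I_m) (k : 'I_p) :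
  s 15 (j * p + k)%N = (mark c d B C j k)%:Z.
Proof.
rewrite (map_solve (s_eq (isT : 28 < 33)%N) dims_mp) ?pair_lt //; evaluate.
rewrite !pairE mul_bool frac_val /mark.
have Ed := scales_add (store_start_item j) (store_greedy j).
have Ee := scales_add (store_start_knapsack k) (store_eff k).
rewrite (scales_lt (store_start_knapsack k) Ed) (scales_le Ed Ee).
rewrite (scales_le (store_start_knapsack k) (store_start_item j)).
rewrite (scales_lt (store_start_item j) Ee) [s 51 j <= 0]leNgt store_late.
by case: (fractional c d B C j k); case: (late c d B C j);
  case: (start B C k < _); case: (_ <= start B C k + C k);
  case: (start B C k <= _); case: (start c d j < _).
Qed.

Let d_bounds : forall j, 0 <= d j <= c j.
Proof. exact: greedy_bounds rk_inj c_ge0. Qed.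

Let Cap_ge0 i : 0 <= Cap i.
Proof. by apply: sumr_ge0 => k _; apply: C_ge0. Qed.

Let chain : forall i, \sum_(t | c i <= c t) d t <= room B C (c i).
Proof. exact: sum_greedy_chain rk_inj c_ge0 Cap_ge0. Qed.

Let separated a b : partial c d a -> partial c d b -> prec c a b ->
  exists2 i, c b < c i <= c a & tight c d B C i.
Proof.
move=> pa pb ab.
have nab : a <> b by move=> eab; rewrite eab precxx in ab.
have [i ci Ei] := greedy_separated rk_inj c_ge0 Cap_ge0 pa pb (prec_le ab) nab.
by exists i => //; apply/eqP.
Qed.

Definition solution : 'M[rat]_(m, p) := stair_mx I pi d.

Definition solution_matching : {set 'I_m * 'I_p} :=
  [set e | mark c d B C e.1 e.2].

Lemma solution_feasible : lp_feasible I pi solution.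
Proof. exact: stair_mx_feasible. Qed.

Lemma solution_optimal : lp_optimal I pi solution.
Proof.
split=> [|x fx]; first exact: solution_feasible.
rewrite stair_mx_value //.
have -> : lp_value I x = \sum_j profit I j / cost I j * (c j * \sum_k x j k).
  by apply: eq_bigr => j _; rewrite mulrA divfK // lt0r_neq0 ?c_gt0.
(* Measured in cost units, the row totals of any solution become feasible amounts, and profits
   become densities. *)
apply: (@greedy_optimal _ _ rk c Cap rk_inj Cap_ge0 density
  (fun j => c j * \sum_k x j k)) => [j|i j|j|i].
- by rewrite divr_ge0 // ltW // ?(profit_gt0 vI) ?c_gt0.
- exact: rank_le.
- have := lp_item fx j.
  have : 0 <= \sum_k x j k.
    by apply: sumr_ge0 => k _; case/andP: (lp_box fx j k).
  by have := c_gt0 j; nra.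
by have := lp_chain vI (c i) fx.
Qed.

Lemma solution_fractional j k :
  (0 < solution j k < 1) = fractional c d B C j k.
Proof.
rewrite /fractional mxE ltr_pdivrMr ?(cost_gt0 vI) // mul1r.
by rewrite pmulr_lgt0 // invr_gt0 (cost_gt0 vI).
Qed.

Lemma solution_saturating :
  saturating_matching (support_graph solution) solution_matching.
Proof.
split; [split|].
- apply/subsetP => e; rewrite !inE solution_fractional.
  exact: mark_fractional.
- move=> [j k] [j' k']; rewrite !inE /= => mk mk' [/= ej|/= ek].
    rewrite -ej in mk' *; congr (_, _); exact: mark_fun C_ge0 _ _ _ mk mk'.
  rewrite -ek in mk' *; congr (_, _).
  exact: mark_inj d_bounds C_ge0 chain separated _ _ _ mk mk'.
move=> j k; rewrite inE solution_fractional => fjk.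
have [k' mk'] := mark_exists d_bounds C_ge0 chain fjk.
by exists k'; rewrite inE.
Qed.

Let x := solution.
Let M := solution_matching.

Lemma solution_stored a : (a == 11%N) || (a == 13%N) -> stores_mx s a x.
Proof.
have nz (j : 'I_m) (k : 'I_p) : s 12 (j * p + k)%N != 0.
  by rewrite (scales_eq (store_item_cost j k) scales0) lt0r_neq0 ?c_gt0.
have E (j : 'I_m) (k : 'I_p) :
    x j k = (s 11 (j * p + k)%N)%:~R / (s 12 (j * p + k)%N)%:~R.
  rewrite mxE store_stair store_item_cost -mulf_div divff ?mulr1 //.
  exact: lt0r_neq0.
case/orP => /eqP -> j k; first by rewrite nz E.
rewrite (map_solve (s_eq (isT : 25 < 33)%N) dims_mp) ?pair_lt //; evaluate.
rewrite (map_solve (s_eq (isT : 26 < 33)%N) dims_mp) ?pair_lt //; evaluate.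
by rewrite nz E.
Qed.

Lemma whole_val (j : 'I_m) (k : 'I_p) :
  (s 11 (j * p + k)%N == s 12 (j * p + k)%N) = (x j k == 1).
Proof.
rewrite (scales_eq (store_stair j k) (store_item_cost j k)) mxE.
have c0 := cost_gt0 vI j; rewrite -/c.
by rewrite -[RHS](inj_eq (mulIf (lt0r_neq0 c0))) mul1r divfK ?lt0r_neq0.
Qed.

Lemma sum_pairs (V : nmodType) (F : nat -> V) :
  \sum_(t < m * p) F t = \sum_(j < m) \sum_(k < p) F (j * p + k)%N.
Proof.
elim: m => [|a IH]; first by rewrite !big_ord0.
rewrite big_ord_recr /= -IH -!(big_mkord xpredT) mulSn addnC.
rewrite (@big_cat_nat _ _ _ (a * p)%N) ?leq_addr //=; congr (_ + _).
rewrite -{1}[(a * p)%N]add0n big_addn addKn big_mkord.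
by apply: eq_bigr => k _; rewrite addnC.
Qed.

Lemma scales_lp_value (b : 'I_m -> 'I_p -> bool) (F : nat -> int) :
  (forall (j : 'I_m) (k : 'I_p), F (j * p + k)%N = (b j k)%:Z * s 34 j) ->
  scales (\sum_(t < m * p) F t) (lp_value I (\matrix_(j, k) (b j k)%:R)).
Proof.
move=> E; rewrite sum_pairs /scales rmorph_sum /= /lp_value mulr_suml.
apply: eq_bigr => j _; rewrite rmorph_sum /= mulr_sumr mulr_suml.
apply: eq_bigr => k _; rewrite E mxE rmorphM /= scales_profit.
by case: (b j k); rewrite ?mul1r ?mulr1 ?mul0r ?mulr0 ?mul0r.
Qed.

Let cand_1 := cand1 x.
Let cand_2 := cand2 I pi x M.
Let cand_3 := cand3 I pi x M.

Let split_val (P : pred 'I_p) j k :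
  [&& 0 < x j k < 1, P k & (j, k) \in M] = mark c d B C j k && P k.
Proof.
rewrite inE solution_fractional /=.
case: (boolP (mark c d B C j k)) => [mk|_]; last by rewrite !andbF.
by rewrite (mark_fractional mk) andbT.
Qed.

Lemma store_value1 : scales (s 53 0) (lp_value I cand_1).
Proof.
rewrite (sum_solve (s_eq (isT : 29 < 33)%N) (erefl _) dims_mp) //; evaluate.
rewrite add0r.
apply: (@scales_lp_value (fun j k => x j k == 1)
  (fun t => expr_val (env s 0 t%:Z) (Eprofit (Ewhole (cell 21)) (cell 21)))).
by move=> j k; evaluate; rewrite !pairE whole_val.
Qed.

Lemma not_val (b : bool) : 1 - b%:Z = (~~ b)%:Z.
Proof. by case: b. Qed.

Lemma store_value2 : scales (s 54 0) (lp_value I cand_2).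
Proof.
rewrite (sum_solve (s_eq (isT : 30 < 33)%N) (erefl _) dims_mp) //; evaluate.
rewrite add0r.
apply: (@scales_lp_value (fun j k => [&& _, _ & _])
  (fun t => expr_val (env s 0 t%:Z) (Eprofit (Esplit2 (cell 21)) (cell 21)))).
move=> j k.
have E : [&& 0 < x j k < 1, ~~ critical I pi k & (j, k) \in M]
  = mark c d B C j k && ~~ critical I pi k.
  exact: (split_val (fun k => ~~ critical I pi k)).
rewrite E /Eprofit /Esplit2 /Enot; evaluate.
by rewrite !pairE store_mark store_critical not_val mul_bool.
Qed.

Lemma store_value3 : scales (s 55 0) (lp_value I cand_3).
Proof.
rewrite (sum_solve (s_eq (isT : 31 < 33)%N) (erefl _) dims_mp) //; evaluate.
rewrite add0r.
apply: (@scales_lp_value (fun j k => [&& _, _ & _])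
  (fun t => expr_val (env s 0 t%:Z) (Eprofit (Esplit3 (cell 21)) (cell 21)))).
move=> j k; rewrite (split_val (critical I pi)) /Eprofit /Esplit3; evaluate.
by rewrite !pairE store_mark store_critical mul_bool.
Qed.

Definition output : 'M[rat]_(m, p) :=
  \matrix_(j, k) (s 16 (j * p + k)%N)%:~R.

Lemma outputE : output =
  if (lp_value I cand_2 <= lp_value I cand_1)
     && (lp_value I cand_3 <= lp_value I cand_1) then cand_1
  else if lp_value I cand_3 <= lp_value I cand_2 then cand_2 else cand_3.
Proof.
have E1 := store_value1; have E2 := store_value2; have E3 := store_value3.
rewrite -(scales_le E2 E1) -(scales_le E3 E1) -(scales_le E3 E2).
apply/matrixP => j k; rewrite mxE.
rewrite (map_solve (s_eq (isT : 32 < 33)%N) dims_mp) ?pair_lt //.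
rewrite /Enot; evaluate.
rewrite !pairE store_mark store_critical whole_val.
have E2' : [&& 0 < x j k < 1, ~~ critical I pi k & (j, k) \in M]
  = mark c d B C j k && ~~ critical I pi k.
  exact: (split_val (fun k => ~~ critical I pi k)).
have E3' := split_val (critical I pi) j k.
case: (s 54 0 <= s 53 0); case: (s 55 0 <= s 53 0); case: (s 55 0 <= s 54 0);
  rewrite ?(mul1r, mul0r, subrr, subr0, addr0, add0r) [RHS]/= [RHS]mxE ?E2' ?E3' //;
  by case: (mark c d B C j k); case: (critical I pi k).
Qed.

Lemma solution_run : algorithm2_run I pi x x M output.
Proof.
split.
- exact: ixpi.
- exact: solution_optimal.
- exact: solution_feasible.
- by exists M; apply: solution_saturating.
- by [].
- exact: solution_saturating.
- rewrite outputE; do 2 ?case: ifP => _; by rewrite !inE eqxx ?orbT.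
move=> y'; rewrite outputE !inE.
by move=> /or3P[] /eqP ->; rewrite -/cand_1 -/cand_2 -/cand_3;
  case: (leP (lp_value I cand_2) (lp_value I cand_1)) => h1;
  case: (leP (lp_value I cand_3) (lp_value I cand_1)) => h2;
  case: (leP (lp_value I cand_3) (lp_value I cand_2)) => h3;
  rewrite [X in _ <= lp_value I X]/=; lra.
Qed.

Lemma solution_stored_run : stores_run s pi x x M output.
Proof.
split.
- exact: store_pos.
- exact: solution_stored.
- exact: solution_stored.
- by move=> j k; rewrite store_mark inE.
by move=> j k; rewrite mxE.
Qed.

End Solution.

Theorem theorem4 :
  (forall (R : realFieldType) (m p q : nat) (I : mkpc R m p q)
          (pi : 'I_p -> nat) (xopt x : 'M[R]_(m, p))
          (M : {set 'I_m * 'I_p}) (y : 'M[R]_(m, p)),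
     mkpc_valid I -> algorithm2_run I pi xopt x M y ->
     exists f : assignment m p,
       [/\ y = mx_of_assignment R f, feasible I f &
           1 / 3 * OPT I <= value I f]) /\
  (exists (c : cmd) (C d : nat),
     implements_algorithm2 c (fun n => C * n ^ d)%N).
Proof.
split; first exact: algorithm2_approx.
have [f [C [d fC]] run] := algorithm_poly.
exists (prog_cmd algorithm), C, d => m p q I vI.
have bI := bounded_encode I.
have dimI i : encode I 0 i = (extent m p q i)%:Z.
  by rewrite /extent /=; case: i => [|[|[|i]]] //=; rewrite !nth_nil.
have [t [s [ex le s_in s_eq]]] := run _ _ _ bI dimI (extent_le I).
exists t, s; split => //; first exact: leq_trans le (fC _ (bounded_gt0 bI)).
exists (pos_in_cluster I), (solution I), (solution I), (solution_matching I),
  (output m p s).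
split; [exact (solution_run vI s_in s_eq)|exact (solution_stored_run vI s_in s_eq)].
Qed.
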